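(* Let $n\ge 1$ and let $\varphi:\mathbb{C}^n\to\mathbb{C}^n$ be a holomorphic mapping. If the composition operator $C_\varphi$ is bounded on the Fock space $\mathcal{F}^2(\mathbb{C}^n)$, then $C_\varphi$ is not supercyclic.
   Context: On $\mathbb{C}^n$ use the inner product $\langle z,w\rangle=\sum_{j=1}^n z_j\overline{w_j}$ and norm $|z|=\sqrt{\langle z,z\rangle}$. The Fock space $\mathcal{F}^2(\mathbb{C}^n)$ is the Hilbert space of all holomorphic functions $f:\mathbb{C}^n\to\mathbb{C}$ with $\|f\|^2=\left(\frac{1}{2\pi}\right)^n\int_{\mathbb{C}^n}|f(z)|^2e^{-|z|^2/2}\,dv(z)<\infty$, where $dv$ is Lebesgue volume measure on $\mathbb{C}^n$. The composition operator is $C_\varphi f=f\circ\varphi$; it is called bounded if it maps $\mathcal{F}^2(\mathbb{C}^n)$ into itself and is a bounded linear operator there. A bounded linear operator $T$ on a space $\mathcal{H}$ is supercyclic if there exists $x\in\mathcal{H}$ such that the projective orbit $\{\lambda T^mx: m=0,1,\ldots,\ \lambda\in\mathbb{C}\}$ is dense in $\mathcal{H}$. *)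

(* Defs.v *)
From HB Require Import structures.
From mathcomp Require Import all_boot all_order all_algebra.
From mathcomp Require Import complex.
From mathcomp Require Import all_classical all_reals all_analysis.

Set Implicit Arguments.
Unset Strict Implicit.
Unset Printing Implicit Defensive.
Import Order.TTheory GRing.Theory Num.Theory.
Import numFieldNormedType.Exports.
Local Open Scope classical_set_scope.
Local Open Scope ring_scope.

Section power_measure.
Context d (T : measurableType d) (R : realType).
Variable m : {sigma_finite_measure set T -> \bar R}.

Definition tuple_cons n (p : n.-tuple T * T) : n.+1.-tuple T :=
  [tuple of p.2 :: p.1].

Lemma measurable_tuple_cons n :
  measurable_fun [set: n.-tuple T * T] (@tuple_cons n).
Proof. exact: measurable_cons. Qed.

Definition power_step n (mu : {measure set (n.-tuple T) -> \bar R}) :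
    set (n.+1.-tuple T) -> \bar R :=
  pushforward (mu \x m)%E (@tuple_cons n).

Section power_step_measure.
Variables (n : nat) (mu : {measure set (n.-tuple T) -> \bar R}).

Let power_step0 : power_step mu set0 = 0%E.
Proof. by rewrite /power_step /pushforward preimage_set0 measure0. Qed.

Let power_step_ge0 A : (0 <= power_step mu A)%E.
Proof. by rewrite /power_step /pushforward measure_ge0. Qed.

Let power_step_sigma_additive : semi_sigma_additive (power_step mu).
Proof.
move=> F mF tF mUF; rewrite /power_step /pushforward preimage_bigcup.
have mpre i : measurable (@tuple_cons n @^-1` F i).
  by rewrite -[X in measurable X]setTI; exact: measurable_tuple_cons.
apply: measure_semi_sigma_additive => //; last exact: bigcup_measurable.
apply/trivIsetP => i j _ _ ij; rewrite -preimage_setI.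
by move/trivIsetP : tF => -> //; rewrite preimage_set0.
Qed.

HB.instance Definition _ := isMeasure.Build _ _ _ (power_step mu)
  power_step0 power_step_ge0 power_step_sigma_additive.

End power_step_measure.

Fixpoint power_measure n : {measure set (n.-tuple T) -> \bar R} :=
  match n with
  | 0 => \d_([tuple] : 0.-tuple T)
  | k.+1 => power_step (power_measure k)
  end.

End power_measure.

(* R[i] packed as a numFieldType carries the modulus topology, so that
   `differentiable` between spaces over it means complex-differentiable. *)
Definition C (R : realType) : numFieldType := R[i].

Section area.
Variable R : realType.
Local Notation leb := (@lebesgue_measure R).

(* A separate constant because on a bare \x inference finds only the
   sub-probability instance, not the sigma-finite one. *)
Definition area : set (measurableTypeR R * measurableTypeR R) -> \bar R :=
  (leb \x leb)%E.

HB.instance Definition _ := Measure.on area.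

Let area_sigma_finite : sigma_finite setT area.
Proof.
have /sigma_finiteP[F [TF ndF Foo]] := sigma_finiteT leb.
exists (fun n => F n `*` F n).
  rewrite -setXTT TF predeqE => -[x y]; split.
    move=> [/= [n _ Fnx] [k _ Fky]]; exists (maxn n k) => //; split.
    - by move: x Fnx; exact/subsetPset/ndF/leq_maxl.
    - by move: y Fky; exact/subsetPset/ndF/leq_maxr.
  by move=> [n _ []/= ? ?]; split; exists n.
move=> k; have [? ?] := Foo k; split; first exact: measurableX.
by rewrite /area product_measure1E// lte_mul_pinfty// ge0_fin_numE.
Qed.

HB.instance Definition _ := Measure_isSigmaFinite.Build _ _ _ area
  area_sigma_finite.

End area.

Section Cn.
Variables (R : realType) (n : nat).

Definition inner_prod (z w : 'rV[C R]_n) : C R :=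
  \sum_j z 0 j * ((w 0 j)^*)%C.

(* `|z| on 'rV is the sup norm, hence a separate Euclidean norm. *)
Definition euclid_norm (z : 'rV[C R]_n) : R :=
  Num.sqrt (complex.Re (inner_prod z z)).

(* Frechet differentiability uses the sup norm of 'rV, which is equivalent to
   the Euclidean one. *)
Definition holomorphic (W : normedModType (C R)) (f : 'rV[C R]_n -> W) :=
  forall z, differentiable f z.

(* C^n is identified with (R^2)^n through z_j = x_j + i y_j. *)
Definition of_real_coords
    (x : n.-tuple (measurableTypeR R * measurableTypeR R)) : 'rV[C R]_n :=
  \row_j ((tnth x j).1 +i* (tnth x j).2)%C.

Definition volume := power_measure (@area R) n.

Definition fock_sqnorm (f : 'rV[C R]_n -> C R) : \bar R :=
  (((2 * pi)^-1 ^+ n)%:E * \int[volume]_x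
    (Normc.normc (f (of_real_coords x)) ^+ 2
      * expR (- euclid_norm (of_real_coords x) ^+ 2 / 2))%:E)%E.

Definition fock_space : set ('rV[C R]_n -> C R) :=
  [set f | holomorphic f /\ (fock_sqnorm f < +oo)%E].

Definition fock_norm (f : 'rV[C R]_n -> C R) : R :=
  Num.sqrt (fine (fock_sqnorm f)).

Definition composition_operator (phi : 'rV[C R]_n -> 'rV[C R]_n)
  (f : 'rV[C R]_n -> C R) : 'rV[C R]_n -> C R := f \o phi.

End Cn.

(* T is considered as an operator on the subspace H of V, normed by N there;
   N need not be a norm outside H. *)
Section operators.
Variables (R : realType) (V : lmodType (C R)) (H : set V) (N : V -> R).
Variable T : V -> V.

Definition bounded_operator :=
  [/\ forall f, H f -> H (T f),
      forall (a : C R) f g, H f -> H g -> T (a *: f + g) = a *: T f + T g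
    & exists M : R, forall f, H f -> N (T f) <= M * N f].

Definition projective_orbit (f : V) : set V :=
  [set h | exists (m : nat) (a : C R), h = a *: iter m T f].

Definition norm_dense (D : set V) :=
  forall g, H g -> forall e : R, 0 < e -> exists2 h, D h & N (g - h) < e.

Definition supercyclic := exists2 f, H f & norm_dense (projective_orbit f).

End operators.

(* Main.v *)
Require Import Defs.
From HB Require Import structures.
From mathcomp Require Import all_boot all_order all_algebra.
From mathcomp Require Import complex ring lra.
From mathcomp Require Import all_classical all_reals all_analysis.
From mathcomp Require Import measurable_realfun.
Set Implicit Arguments.
Unset Strict Implicit.
Unset Printing Implicit Defensive.
Import Order.TTheory GRing.Theory Num.Theory.
Import numFieldNormedType.Exports.
Import ComplexField.
Local Open Scope classical_set_scope.
Local Open Scope ring_scope.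

(** Write [T] for the composition operator by [phi], and [|z|] for the
    Euclidean norm.

    Why no vector is supercyclic.  Suppose that [phi] fixes a point [p] and that
    the orbit of some [z <> p] is bounded.  Let [f] be supercyclic.  Point
    evaluations are continuous on the Fock space, so whenever [a_k T^(m_k) f]
    tends to [g], the numbers [a_k * f p] tend to [g p], while
    [a_k * f (phi^(m_k) z)] tends to [g z].  As [f] is bounded along the orbit of
    [z], every [g] in the space satisfies [|g z| <= K |g p|] with one constant [K]
    ([supercyclic_ratio]).  This is absurd: the functions
    [w |-> exp (<w, t (z - p)> / 2)] belong to the space, and the ratio of their
    values at [z] and [p] is [exp (t |z - p|^2 / 2)], unbounded in [t].

    Why [phi] has a fixed point and bounded orbits.  The sharp evaluation bound
    [|f c|^2 <= K exp (|c|^2 / 2) N(f)^2] ([fock_eval]), applied to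
    [T (kern u)] at [w] with [u = phi w], gives
    [|phi w|^2 <= |w|^2 + constant] because [N(kern u)^2 = exp (|u|^2 / 2)]
    ([bounded_growth]).  So [phi] grows linearly, and a Liouville theorem
    ([entire_linear_growth]) makes it affine, [phi z = z A + b].  Letting [w] go
    to infinity along lines in the growth inequality shows that [A] is a
    contraction and that [b] is orthogonal to [w A] whenever [|w A| = |w|].
    Hence [b] is orthogonal to the fixed vectors of the adjoint of [A] and lies in
    the range of [1 - A], which yields a fixed point [p]; the orbits satisfy
    [|phi^m z - p| <= |z - p|].

    The complex analysis.  Everything rests on one estimate ([cauchy_bound]): for
    [q] continuous at a point and complex differentiable elsewhere, [4 |q|] at that
    point is at most the sum of the integrals of [|q|] over the sides of any
    surrounding rectangle, each divided by its distance to the point.  It follows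
    from Goursat's theorem for [q z / (z - z0)], which allows the rectangle to be
    shrunk to the point, where the imaginary part of the contour integral is
    computed within an error that vanishes.  Two uses are made of it.  With
    [q] a difference quotient it is Cauchy's estimate for derivatives, whence
    Liouville.  Integrated over the position of each of the four sides it becomes
    a mean value inequality over the plane with a Gaussian weight ([area_mean]),
    whence, by Tonelli, one over [C^n] ([volume_mean]).  Applying the latter to the
    square of [f z * exp (- <z, c> / 2)] turns the Gaussian centred at [c] into the
    weight of the Fock space, with exactly the factor [exp (|c|^2 / 2)]. *)

(** * Differential calculus over a numeric field *)

(** The epsilon-delta form of differentiability.  The calculus of this part is
    carried out over an abstract numeric field and specialized later to the real
    and to the complex numbers. *)
Lemma derivable_dist (K : numFieldType) (h : K -> K) (z : K) : derivable h z 1 ->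
  forall e : K, 0 < e -> exists2 d : K, 0 < d & forall w, `|z - w| < d ->
  `|h w - h z - 'D_1 h z * (w - z)| <= e * `|w - z|.
Proof.
move=> /cvg_ex[l hl] e e0.
have -> : 'D_1 h z = l by exact/cvg_lim.
move/cvgrPdist_le : hl => /(_ _ e0).
rewrite near_withinE => /nbhs_normP[d /= d0 H].
exists d => // w wr.
have [->|wz] := eqVneq w z.
  by rewrite !subrr mulr0 subr0 normr0 mulr0.
have wz0 : w - z != 0 by rewrite subr_eq0.
have := H (w - z); rewrite /ball_/= sub0r normrN distrC => /(_ wr wz0).
rewrite -[(w - z) *: 1]/((w - z) * 1) mulr1 subrK.
have -> : h w - h z - l * (w - z) = - ((l - (w - z)^-1 *: (h w - h z)) * (w - z)).
  rewrite -[_ *: _]/((w - z)^-1 * (h w - h z)) mulrBl.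
  by rewrite [(w - z)^-1 * _]mulrC divfK// opprB.
by move=> K1; rewrite normrN normrM [`|w - z|]distrC ler_wpM2r.
Qed.

Lemma dist_is_derive (K : numFieldType) (h : K -> K) (z l : K) :
  (forall e : K, 0 < e -> exists2 d : K, 0 < d & forall w, `|z - w| < d ->
    `|h w - h z - l * (w - z)| <= e * `|w - z|) -> is_derive z 1 h l.
Proof.
move=> H.
have cv : (fun s => s^-1 *: (h (s *: 1 + z) - h z)) @ 0^' --> l.
  apply/cvgrPdist_le => e /H[d d0 {}H]; rewrite near_withinE.
  apply/nbhs_normP; exists d => // s; rewrite /ball_/= sub0r normrN => sd s0.
  have := H (s + z); rewrite opprD addrA -(addrAC z) subrr sub0r normrN => /(_ sd).
  rewrite addrK => K1.
  rewrite [s *: 1]mulr1 -(@ler_pM2r _ `|s|) ?normr_gt0// -normrM.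
  apply: le_trans K1; rewrite le_eqVlt; apply/orP; left; apply/eqP.
  rewrite -normrN; congr (`|_|); rewrite /GRing.scale/= -[LHS]mulNr opprB mulrBl.
  by rewrite mulrAC mulVf// mul1r.
by apply: DeriveDef; [exact: cvgP cv|exact: cvg_lim cv].
Qed.

Lemma continuous_dist (K : numFieldType) (V W : normedModType K) (f : V -> W) (z : V) :
  (forall e, 0 < e -> exists2 d, 0 < d & forall w, `|z - w| < d -> `|f z - f w| <= e) ->
  {for z, continuous f}.
Proof.
move=> H; apply/cvgrPdist_le => e /H[d d0 {}H].
by apply/nbhs_normP; exists d.
Qed.

Lemma continuous_real_dist (R : realType) (K : numFieldType) (V : normedModType K)
    (f : V -> R) (z : V) :
  (forall e : R, 0 < e -> exists2 d : K, 0 < d & forall w, `|z - w| < d -> `|f z - f w| <= e) ->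
  {for z, continuous f}.
Proof.
move=> H; apply/cvgrPdist_le => e /H[d d0 {}H].
by apply/nbhs_normP; exists d.
Qed.

Lemma derivable_div_sub (K : numFieldType) (q : K -> K) (z0 z : K) :
  derivable q z 1 -> z != z0 -> derivable (fun w => q w / (w - z0)) z 1.
Proof.
move=> qz zz; apply: derivableM => //.
have dz : derivable (fun w : K => w - z0) z 1.
  by apply: derivableB; [exact: derivable_id|exact: derivable_cst].
by apply: derivableV => //; rewrite subr_eq0.
Qed.

Lemma derivable_mulcst (K : numFieldType) (q : K -> K) (u z : K) :
  derivable q z 1 -> derivable (fun w => u * q w) z 1.
Proof. by move=> qz; apply: derivableM. Qed.

Lemma continuous_mulcst (K : numFieldType) (q : K -> K) (u z : K) :
  {for z, continuous q} -> {for z, continuous (fun w => u * q w)}.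
Proof. by move=> qz; exact: (cvgM (cvg_cst u) qz). Qed.

(** The difference quotient at [a], filled in at [a] by an arbitrary value. *)
Lemma derivable_slope (K : numFieldType) (h : K -> K) (a l z : K) :
  derivable h z 1 -> z != a ->
  derivable (fun w => if w == a then l else (h w - h a) / (w - a)) z 1.
Proof.
move=> hz za.
apply: (@near_eq_derivable _ _ _ (fun w => (h w - h a) / (w - a))) => //.
- apply/nbhs_normP; exists `|z - a|; first by rewrite /= normr_gt0 subr_eq0.
  move=> w /=; case: eqVneq => // ->; by rewrite ltxx.
- apply: derivable_div_sub => //.
  by apply: derivableB => //; exact: derivable_cst.
Qed.

Lemma derivable_increment (K : numFieldType) (h : K -> K) (u a : K) :
  (forall z, derivable h z 1) -> derivable (fun z => h (z + u) - h z) a 1.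
Proof.
move=> dh; apply: derivableB => //.
apply/derivable1_diffP; apply: (@differentiable_comp _ _ _ _ (fun z => z + u) h).
  by apply: differentiableD => //; exact: differentiable_cst.
by apply/derivable1_diffP.
Qed.

Lemma increment_approxE (K : comNzRingType) (x1 x2 x3 x4 l m v : K) :
  x1 - x3 - (x2 - x4) - (l - m) * v = (x1 - x2 - l * v) - (x3 - x4 - m * v).
Proof. ring. Qed.

Lemma subrBB (K : comNzRingType) (x1 x2 a b : K) :
  x1 - a - (x2 - b) = x1 - x2 - (a - b).
Proof. ring. Qed.

Lemma differentiable_dot (K : numFieldType) n (a : 'I_n -> K) (b : K) (z : 'rV[K]_n) :
  differentiable (fun z : 'rV[K]_n => \sum_j z 0 j * a j + b) z.
Proof.
apply: differentiableD; last exact: differentiable_cst.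
rewrite [X in differentiable X _](_ : _ = \sum_j (fun z : 'rV[K]_n => z 0 j * a j)).
  apply: differentiable_sum => j; apply: differentiableM; last exact: differentiable_cst.
  exact: differentiable_coord.
by apply/funext => u; rewrite fct_sumE.
Qed.

Lemma differentiable_sqr_mul (K : numFieldType) (V : normedModType K) (f g : V -> K) z :
  differentiable f z -> differentiable g z -> differentiable (fun w => f w * g w * (f w * g w)) z.
Proof. move=> df dg; have H := differentiableM df dg; exact: (differentiableM H H). Qed.

Lemma derivable_line (K : numFieldType) m n (f : 'rV[K]_m -> 'rV[K]_n) (a v : 'rV[K]_m) j z :
  (forall x, differentiable f x) -> derivable (fun t : K => f (a + t *: v) 0 j) z 1.
Proof.
move=> df; apply/derivable1_diffP.
apply: (@differentiable_comp _ _ _ _ (fun t : K => f (a + t *: v))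
  (fun N : 'rV[K]_n => N 0 j)); last exact: differentiable_coord.
apply: (@differentiable_comp _ _ _ _ (fun t : K => a + t *: v) f) => //.
Qed.

(** Additivity comes from the line through [2 k x] and [2 y], whose midpoint is
    [k x + y]. *)
Lemma affine_on_lines_linear (K : numFieldType) (V W : lmodType K) (phi : V -> W) :
  (forall a v t, phi (a + t *: v) = phi a + t *: (phi (a + v) - phi a)) ->
  linear (fun z => phi z - phi 0).
Proof.
move=> H.
have LZ t z : phi (t *: z) = phi 0 + t *: (phi z - phi 0).
  by have := H 0 z t; rewrite !add0r.
have two0 : (2 : K) != 0 by rewrite pnatr_eq0.
have halfK (U : lmodType K) (u : U) : 2^-1 *: (2 *: u) = u.
  by rewrite scalerA mulVf// scale1r.
move=> k x y; set p := phi x - phi 0; set q := phi y - phi 0.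
have := H (2 *: (k *: x)) (2 *: (y - k *: x)) 2^-1.
rewrite -(scalerDr 2 (k *: x)) [k *: x + (y - _)]addrC subrK halfK.
have -> : 2 *: (k *: x) + (y - k *: x) = k *: x + y.
  by rewrite -[2]/(1 + 1) scalerDl scale1r addrACA [k *: x - _]subrr addr0.
move=> ->; rewrite !LZ -/p -/q.
have -> : phi 0 + k *: p - phi 0 = k *: p by rewrite addrC addKr.
have -> : phi 0 + 2 *: q - (phi 0 + 2 *: (k *: p)) = 2 *: (q - k *: p).
  by rewrite opprD addrACA subrr add0r scalerBr.
rewrite halfK -(addrA (phi 0)) (addrC (phi 0)) addrK.
by rewrite -[2]/(1 + 1) scalerDl scale1r addrACA [k *: p - _]subrr addr0.
Qed.

(** * Integrals over segments *)

Section seg_int.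
Variable R : realType.
Implicit Types (f g : R -> R) (a b : R).

Definition cont_seg f a b := forall x, a <= x <= b -> {for x, continuous f}.

Definition seg_int f a b : R :=
  (\int[@lebesgue_measure R]_(x in `[a, b]) f x)%R.

Lemma seg_integrable f a b : cont_seg f a b ->
  (@lebesgue_measure R).-integrable `[a, b] (EFin \o f).
Proof.
move=> cf; apply: continuous_compact_integrable; first exact: segment_compact.
by apply: continuous_in_subspaceT => x; rewrite inE/= in_itv => /cf.
Qed.

Lemma cont_segS f a b a' b' : a <= a' -> b' <= b -> cont_seg f a b -> cont_seg f a' b'.
Proof.
move=> aa bb cf x /andP[ax xb]; apply: cf.
by rewrite (le_trans aa ax) (le_trans xb bb).
Qed.

Lemma cont_seg_cst (r a b : R) : cont_seg (fun=> r) a b.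
Proof. by move=> x _; exact: cvg_cst. Qed.

Lemma cont_segD f g a b : cont_seg f a b -> cont_seg g a b -> cont_seg (fun x => f x + g x) a b.
Proof. by move=> cf cg x xab; apply: cvgD; [exact: cf|exact: cg]. Qed.

Lemma cont_segB f g a b : cont_seg f a b -> cont_seg g a b -> cont_seg (fun x => f x - g x) a b.
Proof. by move=> cf cg x xab; apply: cvgB; [exact: cf|exact: cg]. Qed.

Lemma seg_int_split f a b m : a <= m -> m <= b ->
  cont_seg f a b -> seg_int f a b = seg_int f a m + seg_int f m b.
Proof.
move=> am mb cf; rewrite /seg_int; apply/eqP; rewrite addrC -subr_eq; apply/eqP.
have i1 := seg_integrable cf.
rewrite Rintegral_itvB// ?bnd_simp//.
rewrite Rintegral_itv_obnd_cbnd//.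
by apply: integrableS i1 => //; apply: subset_itv; rewrite bnd_simp//.
Qed.

Lemma seg_intD f g a b : cont_seg f a b -> cont_seg g a b ->
  seg_int (fun x => f x + g x) a b = seg_int f a b + seg_int g a b.
Proof. by move=> /seg_integrable cf /seg_integrable cg; exact: RintegralD. Qed.

Lemma seg_intB f g a b : cont_seg f a b -> cont_seg g a b ->
  seg_int (fun x => f x - g x) a b = seg_int f a b - seg_int g a b.
Proof. by move=> /seg_integrable cf /seg_integrable cg; exact: RintegralB. Qed.

Lemma seg_int_cst (r a b : R) : a <= b -> seg_int (fun=> r) a b = r * (b - a).
Proof.
rewrite le_eqVlt /seg_int => ab; rewrite Rintegral_cst//= lebesgue_measure_itv/=.
case/orP: ab => [/eqP ->|ab]; first by rewrite ltxx subrr.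
by rewrite lte_fin ab.
Qed.

Lemma le_seg_int f g a b : cont_seg f a b -> cont_seg g a b ->
  (forall x, a <= x <= b -> f x <= g x) -> seg_int f a b <= seg_int g a b.
Proof.
move=> /seg_integrable cf /seg_integrable cg fg; apply: le_Rintegral => // x; rewrite in_itv; exact: fg.
Qed.

Lemma seg_int_norm_le f a b (M : R) : a <= b -> cont_seg f a b ->
  (forall x, a <= x <= b -> `|f x| <= M) -> `|seg_int f a b| <= M * (b - a).
Proof.
move=> ab cf fM; have cc r : cont_seg (fun=> r) a b by exact: cont_seg_cst.
rewrite ler_norml -mulNr -!seg_int_cst//; apply/andP; split; apply: le_seg_int => // x /fM;
  by rewrite ler_norml => /andP[].
Qed.
End seg_int.

(** * Goursat's theorem for closed forms on rectangles *)

Section goursat.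
Variable R : realType.
Variables P Q : R -> R -> R.

(** The form [P dx + Q dy] is closed at a point: both coefficients have a
    first-order expansion there, and the coefficient of [y] in [P] is that of [x] in
    [Q]. *)
Definition closed_form_at (x0 y0 : R) := exists A B D : R,
  forall e, 0 < e -> exists2 d, 0 < d & forall x y,
    `|x - x0| < d -> `|y - y0| < d ->
    `|P x y - P x0 y0 - A * (x - x0) - B * (y - y0)| <= e * (`|x - x0| + `|y - y0|) /\
    `|Q x y - Q x0 y0 - B * (x - x0) - D * (y - y0)| <= e * (`|x - x0| + `|y - y0|).

Lemma closed_form_continuous x0 y0 : closed_form_at x0 y0 ->
  [/\ {for x0, continuous (fun x => P x y0)} & {for y0, continuous (Q x0)}].
Proof.
move=> [A [B [D /(_ 1 ltr01) [d d0 H]]]].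
have key (F : R -> R) (t0 K : R) :
    (forall t, `|t - t0| < d -> `|F t - F t0 - K * (t - t0)| <= 1 * `|t - t0|) ->
    {for t0, continuous F}.
  move=> HF; apply/cvgrPdist_lt => e e0.
  have K0 : 0 < `|K| + 1 by rewrite ltr_wpDl.
  near=> t.
  have td : `|t - t0| < d by rewrite distrC; near: t; exact: cvgr_dist_lt.
  have te : `|t - t0| < e / (`|K| + 1).
    by rewrite distrC; near: t; apply: cvgr_dist_lt => //; rewrite divr_gt0.
  rewrite distrC (_ : F t - F t0 = (F t - F t0 - K * (t - t0)) + K * (t - t0)); last by ring.
  rewrite (le_lt_trans (ler_normD _ _))//.
  rewrite (@le_lt_trans _ _ ((`|K| + 1) * `|t - t0|))//.
    by rewrite mulrDl addrC normrM lerD// HF.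
  by rewrite mulrC -ltr_pdivlMr.
split.
- apply: (key _ _ A) => t td.
  by have [] := H t y0 td; rewrite ?subrr ?normr0 ?mulr0 ?subr0 ?addr0.
- apply: (key _ _ D) => t td.
  by have [] := H x0 t _ td; rewrite ?subrr ?normr0 ?mulr0 ?subr0 ?add0r.
Unshelve. all: by end_near. Qed.

(** The integral of [P dx + Q dy] along the boundary of the rectangle
    [[a, b] x [c, d]], counterclockwise. *)
Definition contour (a b c d : R) :=
  seg_int (fun x => P x c - P x d) a b + seg_int (fun y => Q b y - Q a y) c d.

Definition closed_on (a b c d : R) :=
  forall x y, a <= x <= b -> c <= y <= d -> closed_form_at x y.

Section seg.
Variables a b c d : R.
Hypothesis H : closed_on a b c d.
Lemma cont_segP y : c <= y <= d -> cont_seg (P ^~ y) a b.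
Proof. by move=> yb x xab; case: (closed_form_continuous (H xab yb)). Qed.
Lemma cont_segQ x : a <= x <= b -> cont_seg (Q x) c d.
Proof. by move=> xab y yb; case: (closed_form_continuous (H xab yb)). Qed.
End seg.

Lemma contour_splitx a m b c d : a <= m -> m <= b ->
  cont_seg (P ^~ c) a b -> cont_seg (P ^~ d) a b ->
  cont_seg (Q a) c d -> cont_seg (Q m) c d -> cont_seg (Q b) c d ->
  contour a b c d = contour a m c d + contour m b c d.
Proof.
move=> am mb c1 c2 c3 c4 c5.
rewrite /contour (@seg_int_split _ _ a b m)//; last exact: cont_segB.
by rewrite !seg_intB//; [ring|exact: cont_segS c1|exact: cont_segS c2|exact: cont_segS c1|exact: cont_segS c2].
Qed.

Lemma contour_splity a b c m d : c <= m -> m <= d ->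
  cont_seg (Q a) c d -> cont_seg (Q b) c d ->
  cont_seg (P ^~ c) a b -> cont_seg (P ^~ m) a b -> cont_seg (P ^~ d) a b ->
  contour a b c d = contour a b c m + contour a b m d.
Proof.
move=> cm md c1 c2 c3 c4 c5.
rewrite /contour (@seg_int_split _ _ c d m)//; last exact: cont_segB.
by rewrite !seg_intB//; [ring|exact: cont_segS c2|exact: cont_segS c1|exact: cont_segS c2|exact: cont_segS c1].
Qed.

(** The linear parts of [P] and [Q] contribute opposite multiples of the area,
    precisely because the form is closed at the point; only the errors remain. *)
Lemma contour_small x0 y0 e : closed_form_at x0 y0 -> 0 < e ->
  exists2 r, 0 < r & forall a b c d, a <= x0 <= b -> c <= y0 <= d ->
    (b - a) + (d - c) < r -> closed_on a b c d ->
    `|contour a b c d| <= e * ((b - a) + (d - c)) ^+ 2.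
Proof.
move=> [A [B [D K]]] e0; have [r r0 {}K] := K (e / 4) ltac:(by rewrite divr_gt0).
exists r => // a b c d /andP[ax xb] /andP[cy yd] sr H.
have ab := le_trans ax xb; have cd := le_trans cy yd.
set s := (b - a) + (d - c) in sr *.
have s0 : 0 <= s by rewrite addr_ge0// subr_ge0.
have dx x : a <= x <= b -> `|x - x0| <= b - a.
  by move=> /andP[? ?]; rewrite ler_norml; apply/andP; split; lra.
have dy y : c <= y <= d -> `|y - y0| <= d - c.
  by move=> /andP[? ?]; rewrite ler_norml; apply/andP; split; lra.
have K' x y : a <= x <= b -> c <= y <= d ->
   `|P x y - P x0 y0 - A * (x - x0) - B * (y - y0)| <= e / 4 * s /\
   `|Q x y - Q x0 y0 - B * (x - x0) - D * (y - y0)| <= e / 4 * s.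
  move=> xab ycd; have h1 := dx _ xab; have h2 := dy _ ycd.
  have [||l1 l2] := K x y.
  - by rewrite (le_lt_trans h1)// (le_lt_trans _ sr)// lerDl subr_ge0.
  - by rewrite (le_lt_trans h2)// (le_lt_trans _ sr)// lerDr subr_ge0.
  have l3 : e / 4 * (`|x - x0| + `|y - y0|) <= e / 4 * s.
    by rewrite ler_wpM2l ?lerD// divr_ge0// ltW.
  by split; [exact: le_trans l1 l3|exact: le_trans l2 l3].
have cc : c <= c <= d by rewrite lexx cd.
have dd : c <= d <= d by rewrite lexx cd.
have aa : a <= a <= b by rewrite lexx ab.
have bb : a <= b <= b by rewrite lexx ab.
have cP : cont_seg (fun x => P x c - P x d) a b.
  by apply: cont_segB; apply: cont_segP H _ _.
have cQ : cont_seg (fun y => Q b y - Q a y) c d.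
  by apply: cont_segB; apply: cont_segQ H _ _.
have -> : contour a b c d =
    seg_int (fun x => P x c - P x d - B * (c - d)) a b +
    seg_int (fun y => Q b y - Q a y - B * (b - a)) c d.
  rewrite (seg_intB cP (@cont_seg_cst _ _ _ _)) (seg_intB cQ (@cont_seg_cst _ _ _ _)) /contour.
  by rewrite !seg_int_cst//; ring.
have -> : e * s ^+ 2 = e / 2 * s * (b - a) + e / 2 * s * (d - c) + e / 2 * s ^+ 2.
  by rewrite /s; field.
have es : 0 <= e / 2 * s ^+ 2 by apply: mulr_ge0; [apply: divr_ge0 => //; exact: ltW|exact: exprn_ge0].
apply: le_trans (ler_normD _ _) _; rewrite -[leLHS]addr0; apply: lerD => //; apply: lerD.
- apply: seg_int_norm_le => //; first by apply: cont_segB => //; exact: cont_seg_cst.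
  move=> x xab; have [l1 _] := K' x c xab cc; have [l2 _] := K' x d xab dd.
  have := lerD l1 l2; rewrite -mulrDl -(_ : e / 2 = e / 4 + e / 4); last by field.
  apply: le_trans; apply: le_trans (ler_normB _ _); rewrite le_eqVlt.
  by apply/orP; left; apply/eqP; congr (`|_|); ring.
- apply: seg_int_norm_le => //; first by apply: cont_segB => //; exact: cont_seg_cst.
  move=> x xab; have [_ l1] := K' b x bb xab; have [_ l2] := K' a x aa xab.
  have := lerD l1 l2; rewrite -mulrDl -(_ : e / 2 = e / 4 + e / 4); last by field.
  apply: le_trans; apply: le_trans (ler_normB _ _); rewrite le_eqVlt.
  by apply/orP; left; apply/eqP; congr (`|_|); ring.
Qed.

Lemma closed_onS a b c d a' b' c' d' :
  a <= a' -> b' <= b -> c <= c' -> d' <= d ->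
  closed_on a b c d -> closed_on a' b' c' d'.
Proof.
move=> aa bb cc dd H x y /andP[? ?] /andP[? ?]; apply: H;
  apply/andP; split; lra.
Qed.

(** The four quarters of a rectangle add up to it, so one of them carries at
    least a quarter of its contour integral. *)
Lemma bisect a c w h : 0 <= w -> 0 <= h -> closed_on a (a + w) c (c + h) ->
  exists i j : bool, let a' := a + w / 2 *+ i in let c' := c + h / 2 *+ j in
   `|contour a (a + w) c (c + h)| <=
     4 * `|contour a' (a' + w / 2) c' (c' + h / 2)|.
Proof.
move=> w0 h0 H.
have ew (x z : R) : x + z / 2 + z / 2 = x + z by field.
have cP y x1 x2 : a <= x1 -> x2 <= a + w -> c <= y <= c + h -> cont_seg (P ^~ y) x1 x2.
  by move=> ax xa /(cont_segP H); exact: cont_segS.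
have cQ x y1 y2 : c <= y1 -> y2 <= c + h -> a <= x <= a + w -> cont_seg (Q x) y1 y2.
  by move=> ax xa /(cont_segQ H); exact: cont_segS.
rewrite (@contour_splitx a (a + w / 2)) ?(@contour_splity _ _ c (c + h / 2) (c + h));
  try lra; try (apply: cP; lra); try (apply: cQ; lra).
set u1 := contour a (a + w / 2) c _; set u2 := contour a _ (c + h / 2) _.
set u3 := contour (a + w / 2) _ c _; set u4 := contour (a + w / 2) _ _ _.
have [l1|l1] := leP `|u1 + u2 + (u3 + u4)| (4 * `|u1|).
  by exists false, false; rewrite /= !mulr0n !addr0.
have [l2|l2] := leP `|u1 + u2 + (u3 + u4)| (4 * `|u2|).
  by exists false, true; rewrite /= !mulr0n !addr0 ew.
have [l3|l3] := leP `|u1 + u2 + (u3 + u4)| (4 * `|u3|).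
  by exists true, false; rewrite /= !mulr0n !addr0 ew.
have [l4|l4] := leP `|u1 + u2 + (u3 + u4)| (4 * `|u4|).
  by exists true, true; rewrite /= !ew.
exfalso.
have := ler_normD (u1 + u2) (u3 + u4).
have := ler_normD u1 u2; have := ler_normD u3 u4; lra.
Qed.
End goursat.

Lemma nested_segments (R : realType) (x y : nat -> R) :
  (forall n, x n <= x n.+1) -> (forall n, y n.+1 <= y n) ->
  (forall n, x n <= y n) -> exists l, forall n, x n <= l <= y n.
Proof.
move=> hx hy xy.
have nx : {homo x : m n / (m <= n)%N >-> m <= n} by exact: homo_leq lexx le_trans hx.
have ny : {homo y : m n / (m <= n)%N >-> n <= m}.
  by apply: (homo_leq (r := fun u v => v <= u)) => // a b c ba cb; exact: le_trans cb ba.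
have xym m n : x m <= y n.
  apply: le_trans (nx _ _ (leq_maxl m n)) _.
  exact: le_trans (xy _) (ny _ _ (leq_maxr m n)).
exists (sup (range x)) => n; apply/andP; split.
- by apply: ub_le_sup; [exists (y 0%N) => _ [m _ <-]|exists n].
- by apply: ge_sup; [exists (x 0%N), 0%N|move=> _ [m _ <-]].
Qed.

(** Repeated bisection produces nested rectangles that shrink to a point and
    whose contour integrals are at least [4^-n] times the first one.  Their squared
    sizes also decrease like [4^-n], so the estimate near the limit point bounds the
    first integral by an arbitrary multiple of a fixed number. *)
Lemma goursat (R : realType) (P Q : R -> R -> R) (a b c d : R) :
  a <= b -> c <= d -> closed_on P Q a b c d -> contour P Q a b c d = 0.
Proof.
move=> ab cd H.
pose w n : R := (b - a) / 2 ^+ n; pose h n : R := (d - c) / 2 ^+ n.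
have p2 n : 0 < 2 ^+ n :> R by rewrite exprn_gt0.
have w_ge0 n : 0 <= w n by rewrite divr_ge0 ?subr_ge0// ltW.
have h_ge0 n : 0 <= h n by rewrite divr_ge0 ?subr_ge0// ltW.
have wS n : w n.+1 = w n / 2 by rewrite /w exprSr invfM mulrA.
have hS n : h n.+1 = h n / 2 by rewrite /h exprSr invfM mulrA.
pose J n (p : R * R) := contour P Q p.1 (p.1 + w n) p.2 (p.2 + h n).
pose K n (p : R * R) := closed_on P Q p.1 (p.1 + w n) p.2 (p.2 + h n).
have /choice[f Hf] (np : nat * (R * R)) : exists q : R * R,
    let n := np.1 in let p := np.2 in K n p ->
    [/\ `|J n p| <= 4 * `|J n.+1 q|, p.1 <= q.1, q.1 + w n.+1 <= p.1 + w n,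
        p.2 <= q.2 & q.2 + h n.+1 <= p.2 + h n].
  case: np => n p /=; have [Kp|] := pselect (K n p); last by exists p.
  have [i [j /= ij]] := bisect (w_ge0 n) (h_ge0 n) Kp.
  exists (p.1 + w n / 2 *+ i, p.2 + h n / 2 *+ j) => _ /=.
  rewrite /J /= wS hS; split => //.
  - by rewrite lerDl mulrn_wge0// divr_ge0.
  - by have := w_ge0 n; case: (i) => /=; rewrite ?mulr0n ?mulr1n; lra.
  - by rewrite lerDl mulrn_wge0// divr_ge0.
  - by have := h_ge0 n; case: (j) => /=; rewrite ?mulr0n ?mulr1n; lra.
pose u := fix u n := if n is m.+1 then f (m, u m) else (a, c).
have uK n : K n (u n).
  elim: n => [|n IH]; first by rewrite /K /= /w /h expr0 !divr1 !subrKC.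
  have [_ h1 h2 h3 h4] := Hf (n, u n) IH.
  exact: closed_onS h1 h2 h3 h4 IH.
have uS n := Hf (n, u n) (uK n).
have uJ n : `|contour P Q a b c d| <= 4 ^+ n * `|J n (u n)|.
  elim: n => [|n IH]; first by rewrite /J /= /w /h !expr0 !divr1 !subrKC mul1r.
  apply: le_trans IH _; rewrite exprSr -mulrA ler_wpM2l ?exprn_ge0//.
  by case: (uS n).
have [x0 Hx] : exists l, forall n, (u n).1 <= l <= (u n).1 + w n.
  apply: nested_segments => n; last by rewrite lerDl.
  - by case: (uS n).
  - by case: (uS n).
have [y0 Hy] : exists l, forall n, (u n).2 <= l <= (u n).2 + h n.
  apply: nested_segments => n; last by rewrite lerDl.
  - by case: (uS n).
  - by case: (uS n).
apply/eqP; rewrite -normr_le0 leNgt; apply/negP => E0.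
set E := `|_| in uJ E0; pose S := (b - a) + (d - c).
have S0 : 0 <= S by apply: addr_ge0; rewrite subr_ge0.
have S1 : 0 < S ^+ 2 + 1 by apply: ltr_wpDl => //; exact: exprn_ge0.
have whS n : w n + h n = S / 2 ^+ n by rewrite /w /h -mulrDl.
have cl : closed_form_at P Q x0 y0.
  by have := uK 0%N x0 y0 (Hx 0%N) (Hy 0%N).
(* the factor is chosen so that [E <= E * S ^+ 2 / (S ^+ 2 + 1)] would follow *)
have [r r0 Hr] := contour_small cl (divr_gt0 E0 S1).
have [n Sn] : exists n, S / 2 ^+ n < r.
  exists (Num.bound (S / r)); set n := Num.bound _.
  rewrite ltr_pdivrMr// mulrC -ltr_pdivrMr//.
  have : S / r < n%:R by apply: archi_boundP; rewrite divr_ge0// ltW.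
  move=> /lt_le_trans; apply; rewrite -natrX ler_nat ltnW//.
  exact: ltn_expl.
have [addK1 addK2] : (u n).1 + w n - (u n).1 = w n /\ (u n).2 + h n - (u n).2 = h n.
  by split; rewrite addrAC subrr add0r.
have := Hr _ _ _ _ (Hx n) (Hy n); rewrite addK1 addK2 whS => /(_ Sn (uK n)).
rewrite -/(J n (u n)) => JS.
have : E <= 4 ^+ n * (E / (S ^+ 2 + 1) * (S / 2 ^+ n) ^+ 2).
  by apply: le_trans (uJ n) _; rewrite ler_wpM2l ?exprn_ge0.
have -> : (4 : R) ^+ n = 2 ^+ n ^+ 2 by rewrite -exprM mulnC exprM; congr (_ ^+ _); ring.
have -> : (2 ^+ n) ^+ 2 * (E / (S ^+ 2 + 1) * (S / 2 ^+ n) ^+ 2) =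
    E * (S ^+ 2 / (S ^+ 2 + 1)) :> R.
  by field; rewrite !gt_eqF.
rewrite leNgt => /negP; apply.
by rewrite gtr_pMr// ltr_pdivrMr// mul1r ltrDl.
Qed.

(** * Complex derivatives as closed forms *)

Section cplx.
Variable R : realType.
Local Notation normc := Normc.normc.
Implicit Types z w : C R.

Lemma norm_modulus z : `|z| = ((normc z)%:C)%C.
Proof. by []. Qed.

Lemma lt_real_complex (x y : R) : ((x%:C)%C < (y%:C)%C :> C R) = (x < y).
Proof. exact: ltcR. Qed.

Lemma modulusN z : normc (- z) = normc z.
Proof. exact: normcN. Qed.

Lemma modulus_ge0 z : 0 <= normc z.
Proof. by case: z => a b; exact: sqrtr_ge0. Qed.

Lemma pos_complexP (e : C R) : 0 < e -> exists2 r : R, 0 < r & e = (r%:C)%C.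
Proof. by case: e => a b; rewrite ltcE/= => /andP[/eqP -> a0]; exists a. Qed.

Definition has_cderiv (h : C R -> C R) (z l : C R) := forall e : R, 0 < e -> exists2 d : R, 0 < d & forall w,
  normc (w - z) < d -> normc (h w - h z - l * (w - z)) <= e * normc (w - z).

Lemma derivable_eps (h : C R -> C R) z : derivable h z 1 ->
  exists l : C R, has_cderiv h z l.
Proof.
move=> hz; exists ('D_1 h z) => e e0.
have e0c : 0 < (e%:C)%C :> C R by rewrite lt_real_complex.
have [d /pos_complexP[r r0 ->] H] := derivable_dist hz e0c.
exists r => // w wr; have := H w.
by rewrite !norm_modulus -rmorphM lt_real_complex lecR -modulusN opprB => /(_ wr).
Qed.

Lemma continuous_eps (h : C R -> C R) z : {for z, continuous h} ->
  forall e : R, 0 < e -> exists2 d : R, 0 < d & forall w,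
  normc (w - z) < d -> normc (h w - h z) < e.
Proof.
move=> hz e e0; have e0c : 0 < (e%:C)%C :> C R by rewrite lt_real_complex.
move/cvgrPdist_lt : hz => /(_ _ e0c) /nbhs_normP[d /= /pos_complexP[r r0 ->] H].
exists r => // w; rewrite -modulusN opprB => wr.
by have := H w; rewrite /ball_/= norm_modulus lt_real_complex => /(_ wr); rewrite norm_modulus lt_real_complex -modulusN opprB.
Qed.

Lemma Re_le_modulus z : `|complex.Re z| <= normc z.
Proof. by have := normc_ge_Re z; rewrite norm_modulus lecR. Qed.

Lemma Im_le_modulus z : `|complex.Im z| <= normc z.
Proof.
case: z => a b /=; rewrite -sqrtr_sqr ler_wsqrtr// lerDr; exact: sqr_ge0.
Qed.

Lemma modulus_le_ReIm z : normc z <= `|complex.Re z| + `|complex.Im z|.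
Proof.
case: z => a b /=; rewrite -ler_sqr ?nnegrE ?sqrtr_ge0 ?addr_ge0//.
rewrite sqr_sqrtr ?addr_ge0 ?sqr_ge0// sqrrD !real_normK ?num_real//.
by rewrite addrAC lerDl mulrn_wge0// mulr_ge0.
Qed.

(** The imaginary part of the complex form [k(z) dz] is
    [Im k dx + Re k dy]; by the Cauchy-Riemann relations, contained in the linearity
    of the derivative over the complex numbers, it is closed where [k] is
    differentiable. *)
Lemma closed_form_derivable (k : C R -> C R) (x y : R) :
  derivable k ((x +i* y)%C) 1 ->
  closed_form_at (fun x y => complex.Im (k (x +i* y)%C))
                 (fun x y => complex.Re (k (x +i* y)%C)) x y.
Proof.
move=> /derivable_eps[[A B] H]; exists B, A, (- B) => e e0.
have [d d0 {}H] := H e e0.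
exists (d / 2); first by rewrite divr_gt0.
move=> u v ux vy; set w : C R := (u +i* v)%C; set z : C R := (x +i* y)%C.
have wz : normc (w - z) <= `|u - x| + `|v - y| by exact: modulus_le_ReIm (w - z).
have /H Hw : normc (w - z) < d by apply: le_lt_trans wz _; rewrite [d]splitr ltrD.
have {}Hw : normc (k w - k z - ((A +i* B)%C : C R) * (w - z)) <= e * (`|u - x| + `|v - y|).
  by apply: le_trans Hw _; rewrite ler_wpM2l// ltW.
split.
- apply: le_trans Hw; apply: le_trans (Im_le_modulus _).
  rewrite /w /z; case: (k _) => a b; case: (k _) => a' b'; simpc => /=.
  rewrite le_eqVlt; apply/orP; left; apply/eqP; congr (`|_|); ring.
- apply: le_trans Hw; apply: le_trans (Re_le_modulus _).
  rewrite /w /z; case: (k _) => a b; case: (k _) => a' b'; simpc => /=.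
  rewrite le_eqVlt; apply/orP; left; apply/eqP; congr (`|_|); ring.
Qed.
End cplx.

(** * A Cauchy estimate with an exceptional centre *)

Lemma modulus_dist (R : realType) (z w : C R) :
  `|Normc.normc z - Normc.normc w| <= Normc.normc (z - w).
Proof.
have t (u v : C R) : Normc.normc u <= Normc.normc (u - v) + Normc.normc v.
  by rewrite -{1}(subrK v u); exact: le_normcD.
have t1 := t z w; have t2 : Normc.normc w <= Normc.normc (z - w) + Normc.normc z.
  by rewrite -(modulusN (z - w)) opprB.
by rewrite ler_norml; apply/andP; split; [rewrite lerNl opprB|]; rewrite lerBlDr.
Qed.

Lemma modulus_real (R : realType) (r : R) : 0 <= r -> Normc.normc ((r%:C)%C : C R) = r.
Proof. by move=> r0 /=; rewrite expr0n/= addr0 sqrtr_sqr ger0_norm. Qed.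

(** Reduces an estimate of a complex value to that of a nonnegative real one. *)
Lemma unimodular (R : realType) (z : C R) :
  exists2 u : C R, Normc.normc u = 1 & u * z = ((Normc.normc z)%:C)%C.
Proof.
have [->|q0] := eqVneq z 0.
  by exists 1; rewrite ?Normc.normc1// Normc.normc0 mulr0.
exists (((Normc.normc z)%:C)%C / z); last by rewrite divfK.
rewrite Normc.normcM Normc.normcV modulus_real ?modulus_ge0// divff//.
by apply: contra q0 => /eqP /Normc.eq0_normc ->.
Qed.

Lemma cont_segMr (R : realType) (f : R -> R) (r a b : R) :
  cont_seg f a b -> cont_seg (fun x => f x * r) a b.
Proof. by move=> cf x xab; exact: (cvgM (cf x xab) (cvg_cst r)). Qed.

Section cauchy.
Variable R : realType.
Local Notation normc := Normc.normc.
Local Notation C := (C R).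

(** The sides are moved inwards one at a time; each move sweeps a rectangle that
    avoids the exceptional point, where Goursat's theorem applies. *)
Lemma contour_shrink (P Q : R -> R -> R) (x0 y0 a b c d a' b' c' d' : R) :
  (forall x y, (x, y) != (x0, y0) -> closed_form_at P Q x y) ->
  a <= a' -> a' < x0 -> x0 < b' -> b' <= b ->
  c <= c' -> c' < y0 -> y0 < d' -> d' <= d ->
  contour P Q a b c d = contour P Q a' b' c' d'.
Proof.
move=> H aa ax xb bb cc cy yd dd.
have cP y x1 x2 : y != y0 -> cont_seg (P ^~ y) x1 x2.
  move=> yy0 x _; have [|//] := closed_form_continuous (H x y _).
  by rewrite xpair_eqE (negbTE yy0) andbF.
have cQ x y1 y2 : x != x0 -> cont_seg (Q x) y1 y2.
  move=> xx0 y _; have [|//] := closed_form_continuous (H x y _).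
  by rewrite xpair_eqE (negbTE xx0).
have z1 x1 x2 y1 y2 : x1 <= x2 -> y1 <= y2 -> (x2 < x0 \/ x0 < x1) -> contour P Q x1 x2 y1 y2 = 0.
  move=> x12 y12 xx; apply: goursat => // x y /andP[? ?] _; apply: H.
  by rewrite xpair_eqE negb_and; apply/orP; left; apply/eqP; case: xx; lra.
have z2 x1 x2 y1 y2 : x1 <= x2 -> y1 <= y2 -> (y2 < y0 \/ y0 < y1) -> contour P Q x1 x2 y1 y2 = 0.
  move=> x12 y12 xx; apply: goursat => // x y _ /andP[? ?]; apply: H.
  by rewrite xpair_eqE negb_and; apply/orP; right; apply/eqP; case: xx; lra.
have nlt (u v : R) : u < v -> u != v by move=> uv; rewrite lt_eqF.
have ngt (u v : R) : u < v -> v != u by move=> uv; rewrite gt_eqF.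
have ax0 := le_lt_trans aa ax; have xb0 := lt_le_trans xb bb.
have cy0 := le_lt_trans cc cy; have yd0 := lt_le_trans yd dd.
have ab' := ltW (lt_trans ax xb); have cd' := ltW (lt_trans cy yd).
have a'b := le_trans ab' bb; have c'd := le_trans cd' dd.
have e1 : contour P Q a b c d = contour P Q a a' c d + contour P Q a' b c d.
  by apply: contour_splitx; try apply: cP; try apply: cQ; auto.
have e2 : contour P Q a' b c d = contour P Q a' b' c d + contour P Q b' b c d.
  by apply: contour_splitx; try apply: cP; try apply: cQ; auto.
have e3 : contour P Q a' b' c d = contour P Q a' b' c c' + contour P Q a' b' c' d.
  by apply: contour_splity; try apply: cP; try apply: cQ; auto.
have e4 : contour P Q a' b' c' d = contour P Q a' b' c' d' + contour P Q a' b' d' d.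
  by apply: contour_splity; try apply: cP; try apply: cQ; auto.
have cd : c <= d by apply: le_trans cc (le_trans cd' dd).
rewrite e1 e2 e3 e4 (z1 a a')// ?(z1 b' b)// ?(z2 _ _ c c')// ?(z2 _ _ d' d)//; auto.
by rewrite add0r !addr0 add0r.
Qed.

(** On a side at distance [rho] from the centre, after a rotation by a quarter
    turn, the integrand of the contour is [Re (q / (rho + i t))]. *)
Lemma Re_div_le (q : C) (rho t : R) : 0 < rho ->
  complex.Re (q / ((rho +i* t)%C : C)) <= normc q / rho.
Proof.
move=> r0; apply: le_trans (ler_norm _) _; apply: le_trans (Re_le_modulus _) _.
rewrite Normc.normcM ler_wpM2l ?modulus_ge0//.
have w0 : 0 < normc ((rho +i* t)%C : C).
  exact: lt_le_trans r0 (le_trans (ler_norm _) (Re_le_modulus ((rho +i* t)%C : C))).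
rewrite Normc.normcV lef_pV2 ?posrE//.
exact: le_trans (ler_norm _) (Re_le_modulus ((rho +i* t)%C : C)).
Qed.

Lemma ReB (z w : C) : complex.Re (z - w) = complex.Re z - complex.Re w.
Proof. by case: z w => a b [c d]. Qed.

Lemma ReN (z : C) : complex.Re (- z) = - complex.Re z.
Proof. by case: z. Qed.

(** For [q] close to a real number [s], and [|t| <= rho], the real part of
    [s / (rho + i t)] is at least [s / (2 rho)]: this replaces the computation of the
    integral of [dz / z] over a square by the lower bound [4]. *)
Lemma Re_div_ge (q : C) (s e rho t : R) : 0 <= s -> 0 < rho -> `|t| <= rho ->
  normc (q - (s%:C)%C) <= e ->
  (s / 2 - e) / rho <= complex.Re (q / ((rho +i* t)%C : C)).
Proof.
move=> s0 r0 tr qe; set w : C := (rho +i* t)%C.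
have -> : q / w = (s%:C)%C / w - (- (q - (s%:C)%C)) / w.
  by rewrite mulNr opprK -mulrDl addrC subrK.
rewrite ReB mulrBl lerB//; last first.
  apply: le_trans (Re_div_le _ _ r0) _; rewrite modulusN.
  by rewrite ler_wpM2r// invr_ge0 ltW.
have n0 : 0 < rho ^+ 2 + t ^+ 2 by rewrite ltr_wpDr ?sqr_ge0// exprn_gt0.
have n1 : rho ^+ 2 + t ^+ 2 <= 2 * rho ^+ 2.
  rewrite mulr_natl mulr2n lerD2l -[t ^+ 2]real_normK ?num_real//.
  by rewrite ler_pXn2r// nnegrE// ltW.
have -> : complex.Re ((s%:C)%C / w) = s * (rho / (rho ^+ 2 + t ^+ 2)).
  by rewrite /w; simpc.
rewrite -mulrA ler_wpM2l// -invfM ler_pdivlMr// mulrC ler_pdivrMr ?mulr_gt0//.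
by apply: le_trans n1 _; rewrite expr2 mulrCA.
Qed.

(** Multiplying the denominator by powers of the imaginary unit carries the four
    sides of a rectangle to a side on the right of the centre. *)
Lemma Re_rot (q : C) (x y : R) :
  [/\ complex.Re (q / ((x +i* y)%C : C)) = - complex.Re (q / (((- x) +i* (- y))%C : C)),
      complex.Im (q / ((x +i* y)%C : C)) = complex.Re (q / (((- y) +i* x)%C : C)) &
      complex.Im (q / ((x +i* y)%C : C)) = - complex.Re (q / ((y +i* (- x))%C : C))].
Proof.
set w : C := (x +i* y)%C.
have e1 : ((- x) +i* (- y))%C = - w :> C by [].
have e2 : ((- y) +i* x)%C = 'i%C * w :> C by rewrite /w; simpc.
have e3 : (y +i* (- x))%C = - ('i%C * w) :> C by rewrite -e2; simpc.
have e4 : complex.Re (q / ('i%C * w)) = complex.Im (q / w).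
  rewrite invfM mulrCA mulrC; case: (q / w) => a b; simpc => /=.
  by rewrite expr0n/= expr1n !add0r !divr1.
by rewrite e1 e3 e2 !invrN !mulrN !ReN e4 !opprK.
Qed.

Variables (q : C -> C) (x0 y0 : R).
Local Notation z0 := ((x0 +i* y0)%C : C).
Hypothesis dq : forall z, z != z0 -> derivable q z 1.
Hypothesis cq : {for z0, continuous q}.

Definition weighted_perimeter (a b c d : R) :=
  seg_int (fun x => normc (q (x +i* c)%C) / (y0 - c) + normc (q (x +i* d)%C) / (d - y0)) a b
+ seg_int (fun y => normc (q (b +i* y)%C) / (b - x0) + normc (q (a +i* y)%C) / (x0 - a)) c d.

Let k z := q z / (z - z0).

Lemma cauchy_form x y : (x, y) != (x0, y0) -> closed_form_at
  (fun x y => complex.Im (k (x +i* y)%C)) (fun x y => complex.Re (k (x +i* y)%C)) x y.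
Proof.
move=> xy; apply: closed_form_derivable.
have z : (x +i* y)%C != z0.
  by apply: contra xy => /eqP[-> ->].
exact: derivable_div_sub (dq z) z.
Qed.
Lemma cont_seg_normc (h : C -> C) (a b : R) (g : R -> C) :
  (forall t, a <= t <= b -> {for g t, continuous h}) ->
  (forall t u, normc (g t - g u) <= `|t - u|) ->
  cont_seg (fun t => normc (h (g t))) a b.
Proof.
move=> hg gg t tab; apply/cvgrPdist_lt => e e0.
have [r r0 H] := continuous_eps (hg t tab) e0.
near=> u; rewrite distrC.
have : normc (h (g u) - h (g t)) < e.
  apply: H; apply: le_lt_trans (gg _ _) _; rewrite distrC.
  by near: u; exact: cvgr_dist_lt.
apply: le_lt_trans; exact: modulus_dist.
Unshelve. all: by end_near. Qed.

Lemma punctured_continuous z : z != z0 -> {for z, continuous q}.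
Proof. by move=> /dq /derivable1_diffP /differentiable_continuous. Qed.

Lemma cont_horizontal (a b c r : R) : c != y0 ->
  cont_seg (fun x => normc (q (x +i* c)%C) / r) a b.
Proof.
move=> cy; apply: cont_segMr.
apply: (@cont_seg_normc q a b (fun x => (x +i* c)%C)) => [t _|t u].
- by apply: punctured_continuous; apply: contra cy => /eqP[_ ->].
- by apply: le_trans (modulus_le_ReIm _) _; rewrite /= subrr normr0 addr0.
Qed.

Lemma cont_vertical (a b c r : R) : c != x0 ->
  cont_seg (fun y => normc (q (c +i* y)%C) / r) a b.
Proof.
move=> cy; apply: cont_segMr.
apply: (@cont_seg_normc q a b (fun y => (c +i* y)%C)) => [t _|t u].
- by apply: punctured_continuous; apply: contra cy => /eqP[->].
- by apply: le_trans (modulus_le_ReIm _) _; rewrite /= subrr normr0 add0r.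
Qed.

Let P x y := complex.Im (k (x +i* y)%C).
Let Q x y := complex.Re (k (x +i* y)%C).

Lemma punctured_cont_P (a b c : R) : c != y0 -> cont_seg (P ^~ c) a b.
Proof.
move=> cy x _; have [|//] := closed_form_continuous (cauchy_form (x := x) (y := c) _).
by rewrite xpair_eqE (negbTE cy) andbF.
Qed.

Lemma punctured_cont_Q (a b c : R) : c != x0 -> cont_seg (Q c) a b.
Proof.
move=> cy x _; have [|//] := closed_form_continuous (cauchy_form (x := c) (y := x) _).
by rewrite xpair_eqE (negbTE cy).
Qed.

Lemma bottom_sideE x c : P x c = complex.Re (q (x +i* c)%C / (((y0 - c) +i* (x - x0))%C : C)).
Proof.
rewrite /P /k; have [_ -> _] := Re_rot (q (x +i* c)%C) (x - x0) (c - y0).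
by rewrite opprB.
Qed.

Lemma top_sideE x d : - P x d =
  complex.Re (q (x +i* d)%C / (((d - y0) +i* (x0 - x))%C : C)).
Proof.
rewrite /P /k; have [_ _ ->] := Re_rot (q (x +i* d)%C) (x - x0) (d - y0).
by rewrite opprK opprB.
Qed.

Lemma right_sideE b y : Q b y = complex.Re (q (b +i* y)%C / (((b - x0) +i* (y - y0))%C : C)).
Proof. by []. Qed.

Lemma left_sideE a y : - Q a y =
  complex.Re (q (a +i* y)%C / (((x0 - a) +i* (y0 - y))%C : C)).
Proof.
rewrite /Q /k; have [-> _ _] := Re_rot (q (a +i* y)%C) (a - x0) (y - y0).
by rewrite opprK !opprB.
Qed.

Lemma contour_le (a b c d : R) : a < x0 -> x0 < b -> c < y0 -> y0 < d ->
  contour P Q a b c d <= weighted_perimeter a b c d.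
Proof.
move=> ax xb cy yd.
have [na nb nc nd] : [/\ a != x0, b != x0, c != y0 & d != y0].
  by rewrite (lt_eqF ax) (lt_eqF cy) (gt_eqF xb) (gt_eqF yd).
apply: lerD; apply: le_seg_int.
- by apply: cont_segB; apply: punctured_cont_P.
- by apply: cont_segD; apply: cont_horizontal.
- by move=> x _; rewrite bottom_sideE top_sideE; apply: lerD; apply: Re_div_le; rewrite subr_gt0.
- by apply: cont_segB; apply: punctured_cont_Q.
- by apply: cont_segD; apply: cont_vertical.
- by move=> x _; rewrite right_sideE left_sideE; apply: lerD; apply: Re_div_le; rewrite subr_gt0.
Qed.

Lemma contour_ge (s e rho : R) : 0 <= s -> 0 < rho ->
  (forall x y, `|x - x0| <= rho -> `|y - y0| <= rho ->
     normc (q (x +i* y)%C - (s%:C)%C) <= e) ->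
  4 * s - 8 * e <= contour P Q (x0 - rho) (x0 + rho) (y0 - rho) (y0 + rho).
Proof.
move=> s0 r0 H; set L := (s / 2 - e) / rho.
have side (u : R) : (L + L) * (u + rho - (u - rho)) = 2 * s - 4 * e.
  by rewrite /L; field; rewrite gt_eqF.
have rN : `|- rho| <= rho by rewrite normrN gtr0_norm.
have rP : `|rho| <= rho by rewrite gtr0_norm.
have ur (u : R) : u - rho < u by rewrite ltrBlDr ltrDl.
have ru (u : R) : u < u + rho by rewrite ltrDl.
have urr (u : R) : u - rho <= u + rho by apply: ltW; exact: lt_trans (ur u) (ru u).
have abs (t u : R) : u - rho <= t <= u + rho -> `|t - u| <= rho.
  by move=> /andP[? ?]; rewrite ler_norml; apply/andP; split; lra.
have -> : 4 * s - 8 * e = (2 * s - 4 * e) + (2 * s - 4 * e) by ring.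
have nu (u : R) : u - rho != u by rewrite lt_eqF.
have nu' (u : R) : u + rho != u by rewrite gt_eqF.
have E1 (u : R) : u + rho - u = rho by rewrite addrAC subrr add0r.
have E2 (u : R) : u - rho - u = - rho by rewrite addrAC subrr add0r.
have E3 (u : R) : u - (u - rho) = rho by rewrite opprB addrC subrK.
apply: lerD.
- rewrite -(side x0) -seg_int_cst//; apply: le_seg_int; first exact: cont_seg_cst.
    by apply: cont_segB; apply: punctured_cont_P.
  move=> x /abs xx; rewrite bottom_sideE top_sideE E1 E3.
  apply: lerD; apply: Re_div_ge => //; rewrite 1?distrC//; apply: H => //.
    by rewrite E2.
  by rewrite E1.
- rewrite -(side y0) -seg_int_cst//; apply: le_seg_int; first exact: cont_seg_cst.
    by apply: cont_segB; apply: punctured_cont_Q.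
  move=> x /abs xx; rewrite right_sideE left_sideE E1 E3.
  apply: lerD; apply: Re_div_ge => //; rewrite 1?distrC//; apply: H => //.
    by rewrite E1.
  by rewrite E2.
Qed.

(** Shrink the rectangle to small squares around the centre, on which [q] is
    almost the constant [s]. *)
Lemma cauchy_bound_pos (s a b c d : R) : 0 <= s -> q z0 = (s%:C)%C ->
  a < x0 -> x0 < b -> c < y0 -> y0 < d ->
  4 * s <= weighted_perimeter a b c d.
Proof.
move=> s0 qs ax xb cy yd.
apply/ler_addgt0Pr => e e0; rewrite -lerBlDr.
have e8 : 0 < e / 8 by rewrite divr_gt0.
have [r r0 Hr] := continuous_eps cq e8.
pose rho := Num.min (r / 3) (Num.min (Num.min (x0 - a) (b - x0)) (Num.min (y0 - c) (d - y0))).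
have rho0 : 0 < rho by rewrite !lt_min !subr_gt0 ax xb cy yd divr_gt0.
have [h0 h1 h2 h3 h4] : [/\ rho <= r / 3, rho <= x0 - a, rho <= b - x0, rho <= y0 - c & rho <= d - y0].
  by split; rewrite !ge_min lexx ?orbT.
have -> : e = 8 * (e / 8) by field.
have sm x y : `|x - x0| <= rho -> `|y - y0| <= rho ->
     normc (q (x +i* y)%C - (s%:C)%C) <= e / 8.
  move=> xr yr; rewrite -qs; apply/ltW/Hr.
  by apply: le_lt_trans (modulus_le_ReIm _) _ => /=; lra.
apply: le_trans (contour_ge s0 rho0 sm) _.
rewrite -(@contour_shrink P Q x0 y0 a b c d) ?contour_le//; try lra.
by move=> x y; exact: cauchy_form.
Qed.
End cauchy.

Theorem cauchy_bound (R : realType) (q : C R -> C R) (x0 y0 a b c d : R) :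
  (forall z : C R, z != (x0 +i* y0)%C -> derivable q z 1) ->
  {for (x0 +i* y0)%C : C R, continuous q} ->
  a < x0 -> x0 < b -> c < y0 -> y0 < d ->
  4 * Normc.normc (q (x0 +i* y0)%C) <= weighted_perimeter q x0 y0 a b c d.
Proof.
move=> dq cq ax xb cy yd.
set z0 : C R := (x0 +i* y0)%C in dq cq *.
have [u u1 uq] := unimodular (q z0).
have uqn z : Normc.normc (u * q z) = Normc.normc (q z) by rewrite Normc.normcM u1 mul1r.
have -> : weighted_perimeter q x0 y0 a b c d =
    weighted_perimeter (fun z => u * q z) x0 y0 a b c d.
  by rewrite /weighted_perimeter; congr (seg_int _ _ _ + seg_int _ _ _); apply/funext => t;
    rewrite !uqn.
refine (@cauchy_bound_pos R (fun z => u * q z) x0 y0 _ _ _ _ _ _ _ (modulus_ge0 _) uq ax xb cy yd).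
- by move=> z zz; exact: derivable_mulcst (dq z zz).
- exact: continuous_mulcst cq.
Qed.

(** * Entire functions of linear growth *)

Section liouville.
Variable R : realType.
Local Notation normc := (@Normc.normc R).
Local Notation C := (C R).
Implicit Types (h q : C -> C) (z w l : C).

Lemma eps_continuous q z :
  (forall e : R, 0 < e -> exists2 d : R, 0 < d & forall w,
    normc (w - z) < d -> normc (q w - q z) <= e) -> {for z, continuous q}.
Proof.
move=> H; apply: continuous_dist => e /pos_complexP[r r0 ->]; have [d d0 {}H] := H r r0.
exists (d%:C)%C; first by rewrite lt_real_complex.
move=> w; rewrite norm_modulus lt_real_complex -modulusN opprB => /H.
by rewrite norm_modulus lecR -modulusN opprB.
Qed.

(** On a square of half-side [r] each of the four sides contributes at most
    [2 M / r * 2 r]. *)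
Lemma cauchy_sup q z0 (M r : R) : (forall z, z != z0 -> derivable q z 1) ->
  {for z0, continuous q} -> 0 < r ->
  (forall z, r <= normc (z - z0) <= 2 * r -> normc (q z) <= M) ->
  normc (q z0) <= 2 * M.
Proof.
case: z0 => x0 y0 dq cq r0 H.
have lt1 (u : R) : u - r < u by rewrite ltrBlDr ltrDl.
have lt2 (u : R) : u < u + r by rewrite ltrDl.
have := cauchy_bound dq cq (lt1 x0) (lt2 x0) (lt1 y0) (lt2 y0).
move=> /le_trans K; rewrite -(@ler_pM2l _ 4)//; apply: K.
have -> : 4 * (2 * M) = 4 * M + 4 * M by ring.
have E1 (u : R) : u + r - u = r by rewrite addrAC subrr add0r.
have E2 (u : R) : u - r - u = - r by rewrite addrAC subrr add0r.
have E3 (u : R) : u - (u - r) = r by rewrite opprB addrC subrK.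
have sd (u : R) : (M / r + M / r) * (u + r - (u - r)) = 4 * M.
  by field; rewrite gt_eqF.
have le12 (u : R) : u - r <= u + r by apply/ltW/lt_trans/lt2.
have n1 (u : R) : u - r != u by rewrite lt_eqF.
have n2 (u : R) : u + r != u by rewrite gt_eqF.
have abs (t u : R) : u - r <= t <= u + r -> `|t - u| <= r.
  by move=> /andP[? ?]; rewrite ler_norml; apply/andP; split; lra.
have K (x y : R) : `|x - x0| <= r -> `|y - y0| <= r ->
    (`|x - x0| = r \/ `|y - y0| = r) -> normc (q (x +i* y)%C) / r <= M / r.
  move=> xr yr xy; rewrite ler_pM2r ?invr_gt0//; apply: H; apply/andP; split.
    by case: xy => <-; [exact: (Re_le_modulus ((x - x0) +i* (y - y0))%C)
                      |exact: (Im_le_modulus ((x - x0) +i* (y - y0))%C)].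
  apply: le_trans (modulus_le_ReIm _) _; rewrite mulr_natl mulr2n.
  exact: lerD.
have rN : `|- r| = r by rewrite normrN gtr0_norm.
have rP : `|r| = r by rewrite gtr0_norm.
apply: lerD.
- rewrite -(sd x0) -seg_int_cst//; apply: le_seg_int; last 1 first.
  + move=> x /abs xr; rewrite E1 E3; apply: lerD; apply: K => //; rewrite ?E1 ?E2 ?rN ?rP//; by right.
  + by apply: cont_segD; apply: (cont_horizontal dq).
  + exact: cont_seg_cst.
- rewrite -(sd y0) -seg_int_cst//; apply: le_seg_int; last 1 first.
  + move=> x /abs xr; rewrite E1 E3; apply: lerD; apply: K => //; rewrite ?E1 ?E2 ?rN ?rP//; by left.
  + by apply: cont_segD; apply: (cont_vertical dq).
  + exact: cont_seg_cst.
Qed.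

(** Cauchy's estimate: the previous bound applied to the difference quotient of
    [h] at [a], which takes the value [l] at [a]. *)
Lemma cauchy_deriv h a l (M r : R) : (forall z, derivable h z 1) ->
  has_cderiv h a l -> 0 < r ->
  (forall z, r <= normc (z - a) <= 2 * r -> normc (h z - h a) <= M) ->
  normc l <= 2 * M / r.
Proof.
move=> dh hl r0 H.
pose q z := if z == a then l else (h z - h a) / (z - a).
have qa : q a = l by rewrite /q eqxx.
rewrite -qa -mulrA; apply: (@cauchy_sup q a (M / r) r _ _ r0).
- move=> z za; exact: derivable_slope (dh z) za.
- apply: eps_continuous => e e0; have [d d0 hd] := hl e e0; exists d => // w wd.
  rewrite qa /q; have [_|wa] := eqVneq w a.
    by rewrite subrr Normc.normc0 ltW.
  have wa0 : w - a != 0 by rewrite subr_eq0.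
  have := hd w wd.
  have -> : h w - h a - l * (w - a) = ((h w - h a) / (w - a) - l) * (w - a).
    by rewrite mulrBl divfK.
  rewrite Normc.normcM ler_pM2r// lt_neqAle modulus_ge0 andbT eq_sym.
  by apply: contra wa0 => /eqP /Normc.eq0_normc ->.
- move=> z zr; rewrite /q; case: eqVneq => [za|za].
    by move: zr; rewrite za subrr Normc.normc0 leNgt r0.
  rewrite Normc.normcM Normc.normcV; case/andP : (zr) => rz _.
  apply: ler_pM; rewrite ?modulus_ge0 ?invr_ge0 ?modulus_ge0//; first exact: H.
  by rewrite lef_pV2 ?posrE// (lt_le_trans r0).
Qed.
End liouville.

Lemma le_of_inv_bound (R : realType) (x y c : R) : 0 <= c ->
  (forall r, 0 < r -> x <= y + c / r) -> x <= y.
Proof.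
move=> c0 H; apply/ler_addgt0Pr => e e0.
have c1 : 0 < c + 1 by rewrite ltr_wpDl.
apply: le_trans (H _ (divr_gt0 c1 e0)) _; rewrite lerD2l invf_div mulrCA.
by rewrite ger_pMr// ler_pdivrMr// mul1r lerDl.
Qed.

Section linear_growth.
Variable R : realType.
Local Notation normc := (@Normc.normc R).
Local Notation C := (C R).
Implicit Types (h q : C -> C) (z w l : C).

Lemma ReM_real z (r : R) : complex.Re (z * ((r%:C)%C : C)) = complex.Re z * r.
Proof. by case: z => a b; simpc. Qed.

(** Rotate [h z - h w] to the positive real axis and apply the real mean value
    theorem to the real part of [h] along the segment. *)
Lemma mvt_bound h (K : R) : 
  (forall z, exists2 l, has_cderiv h z l & normc l <= K) ->
  forall z w, normc (h z - h w) <= K * normc (z - w).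
Proof.
move=> H z w; have [u u1 uh] := unimodular (h z - h w).
have /choice[D HD] : forall a, exists l, has_cderiv h a l /\ normc l <= K.
  by move=> a; have [l ? ?] := H a; exists l.
pose g (t : R) : C := w + ((t%:C)%C * (z - w)).
pose F (t : R) := complex.Re (u * h (g t)).
pose dF (t : R) := complex.Re (u * (D (g t) * (z - w))).
have gB s t : g s - g t = (((s - t)%:C)%C : C) * (z - w).
  by rewrite /g opprD addrACA subrr add0r -mulrBl rmorphB.
have ngB s t : normc (g s - g t) = `|s - t| * normc (z - w).
  rewrite gB Normc.normcM; congr (_ * _).
  by rewrite /= expr0n/= addr0 sqrtr_sqr.
have nzw := modulus_ge0 (z - w).
have dFP (t : R) : is_derive t 1 F (dF t).
  apply: dist_is_derive => e e0.
  have e1 : 0 < e / (normc (z - w) + 1) by rewrite divr_gt0// ltr_wpDl.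
  have [d d0 Hd] := (HD (g t)).1 _ e1.
  exists (d / (normc (z - w) + 1)); first by rewrite divr_gt0// ltr_wpDl.
  move=> s; rewrite distrC => st.
  have sd : normc (g s - g t) < d.
    rewrite ngB; apply: le_lt_trans (_ : `|s - t| * (normc (z - w) + 1) < d).
      by rewrite ler_wpM2l// lerDl.
    by rewrite -ltr_pdivlMr// ltr_wpDl.
  have := Hd _ sd; rewrite ngB => K1.
  have K2 : e / (normc (z - w) + 1) * (`|s - t| * normc (z - w)) <= e * `|s - t|.
    rewrite mulrCA [leRHS]mulrC ler_wpM2l// mulrAC ler_pdivrMr ?ltr_wpDl//.
    by rewrite ler_pM2l// lerDl.
  apply: le_trans (le_trans K1 K2).
  have -> : F s - F t - dF t * (s - t) =
      complex.Re (u * (h (g s) - h (g t) - D (g t) * (g s - g t))).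
    rewrite gB /F /dF; move: (z - w) => v; rewrite !mulrBr !ReB; congr (_ - _ - _).
    by rewrite [D _ * ((s - t)%:C%C * v)]mulrCA [u * ((s - t)%:C%C * _)]mulrCA [in RHS]mulrC ReM_real -mulrBr.
  by apply: le_trans (Re_le_modulus _) _; rewrite Normc.normcM u1 mul1r.
have [c _] := @MVT_segment R F dF 0 1 ler01 (fun t _ => dFP t)
   (@derivable_within_continuous _ _ F `[0, 1] (fun t _ => @ex_derive _ _ _ _ _ _ _ (dFP t))).
rewrite subr0 mulr1 => FF.
have <- : F 1 - F 0 = normc (h z - h w).
  have g1 : g 1 = z by rewrite /g mul1r addrC subrK.
  have g0 : g 0 = w by rewrite /g mul0r addr0.
  by rewrite /F g1 g0 -ReB -mulrBr uh.
rewrite FF; apply: le_trans (ler_norm _) _; apply: le_trans (Re_le_modulus _) _.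
by rewrite !Normc.normcM u1 mul1r ler_wpM2r// (HD _).2.
Qed.
(** Cauchy's estimate with [r] going to infinity bounds the derivative, so [h] is
    Lipschitz and each increment [h (z + u) - h z] is bounded.  The same estimate
    then annihilates the derivative of the increments, that is, the derivative of
    [h] is constant. *)
Theorem entire_linear_growth h (A B : R) : 0 <= B ->
  (forall z, derivable h z 1) -> (forall z, normc (h z) <= A + B * normc z) ->
  exists l, forall z, h z = h 0 + l * z.
Proof.
move=> B0 dh hAB.
have A0 : 0 <= A.
  by apply: le_trans (modulus_ge0 (h 0)) _; have := hAB 0; rewrite Normc.normc0 mulr0 addr0.
have /choice[D HD] : forall a, exists l, has_cderiv h a l.
  by move=> a; exact: derivable_eps (dh a).
have tri z w : normc (z - w) <= normc z + normc w.
  by rewrite -(modulusN w); exact: le_normcD.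
have D4 a : normc (D a) <= 4 * B.
  apply: (@le_of_inv_bound _ _ _ (4 * A + 4 * B * normc a)).
    by rewrite addr_ge0 ?mulr_ge0// modulus_ge0.
  move=> r r0.
  have -> : 4 * B + (4 * A + 4 * B * normc a) / r =
      2 * ((A + B * (normc a + 2 * r)) + (A + B * normc a)) / r.
    by field; rewrite gt_eqF.
  apply: (cauchy_deriv dh (HD a) r0) => z /andP[_ za].
  apply: le_trans (tri _ _) _; apply: lerD => //.
  apply: le_trans (hAB z) _; rewrite lerD2l ler_wpM2l//.
  rewrite -{1}(subrK a z) addrC; apply: le_trans (le_normcD _ _) _.
  by rewrite lerD2l.
have lip z w : normc (h z - h w) <= 4 * B * normc (z - w).
  by apply: mvt_bound => a; exists (D a).
(* the increment by [u] is bounded, so its derivative vanishes *)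
have Dconst u a : D (a + u) - D a = 0.
  apply: Normc.eq0_normc; apply/eqP; rewrite eq_le modulus_ge0 andbT.
  apply: (@le_of_inv_bound _ _ _ (16 * B * normc u)).
    by rewrite mulr_ge0 ?mulr_ge0// modulus_ge0.
  move=> r r0; rewrite add0r.
  have -> : 16 * B * normc u / r = 2 * (4 * B * normc u + 4 * B * normc u) / r.
    by field; rewrite gt_eqF.
  apply: (@cauchy_deriv _ (fun z => h (z + u) - h z) a _ _ r _ _ r0).
  - by move=> z; exact: derivable_increment dh.
  - move=> e e0; have e2 : 0 < e / 2 by rewrite divr_gt0.
    have [d1 d10 H1] := HD (a + u) _ e2; have [d2 d20 H2] := HD a _ e2.
    exists (Num.min d1 d2); first by rewrite lt_min d10.
    move=> w; rewrite lt_min => /andP[wd1 wd2].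
    have E : w + u - (a + u) = w - a by rewrite opprD addrACA subrr addr0.
    have := H1 (w + u); rewrite E => /(_ wd1) {}H1; have {}H2 := H2 w wd2.
    have -> : h (w + u) - h w - (h (a + u) - h a) - (D (a + u) - D a) * (w - a) =
       (h (w + u) - h (a + u) - D (a + u) * (w - a)) - (h w - h a - D a * (w - a)).
      exact: increment_approxE.
    apply: le_trans (tri _ _) _.
    have -> : e = e / 2 + e / 2 by field.
    by rewrite mulrDl; apply: lerD.
  - move=> z _; apply: le_trans (tri _ _) _.
    apply: lerD; apply: le_trans (lip _ _) _.
      by rewrite [z + u]addrC addrK.
    by rewrite [a + u]addrC addrK.
exists (D 0) => z.
have E0 : forall a, exists2 l, has_cderiv (fun z => h z - D 0 * z) a l & normc l <= 0.
  move=> a; exists 0; last by rewrite Normc.normc0.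
  move=> e /(HD a)[d d0 H]; exists d => // w /H; apply: le_trans.
  have -> : D a = D 0.
    by apply/eqP; rewrite -subr_eq0; have := Dconst a 0; rewrite add0r => ->.
  rewrite mul0r subr0 mulrBr le_eqVlt; apply/orP; left; apply/eqP; congr normc.
  exact: subrBB.
have := mvt_bound E0 z 0; rewrite mul0r mulr0 subr0 => Z.
have /Normc.eq0_normc/eqP : normc (h z - D 0 * z - h 0) = 0.
  by apply/eqP; rewrite eq_le Z modulus_ge0.
by rewrite subr_eq0 => /eqP <-; rewrite subrK.
Qed.
End linear_growth.

(** * Measurability of continuous functions of the real coordinates *)

(** A preimage is a countable union of fibres of [D]. *)
Lemma measurable_countable_factor d (T : measurableType d) (S : countType) (R : realType)
    (D : T -> S) (g : S -> R) :
  (forall s, measurable (D @^-1` [set s])) -> measurable_fun setT (g \o D).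
Proof.
move=> mD _ Y mY; rewrite setTI.
have -> : (g \o D) @^-1` Y =
    \bigcup_n (if @unpickle S n is Some s then
                 (if g s \in Y then D @^-1` [set s] else set0) else set0).
  apply/seteqP; split => x.
  - move=> gY; exists (pickle (D x)) => //; rewrite pickleK ifT//.
    by rewrite inE.
  - move=> [n _]; case: unpickle => // s; case: ifPn => //; rewrite inE => gs /= ->.
    exact: gs.
apply: bigcupT_measurable => n; case: unpickle => // s; case: ifPn => // _.
Qed.

Section measurable_coords.
Variable R : realType.
Local Notation C := (C R).
Local Notation normc := (@Normc.normc R).
Local Notation RR := (measurableTypeR R * measurableTypeR R)%type.

Definition grid (k : nat) (x : R) : R := (Num.floor (k.+1%:R * x))%:~R / k.+1%:R.

Lemma grid_dist k x : `|x - grid k x| <= k.+1%:R^-1.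
Proof.
have k0 : 0 < k.+1%:R :> R by [].
have /andP[h1 h2] := floor_itv (k.+1%:R * x).
rewrite -(ler_pM2l k0) divff ?gt_eqF//.
rewrite -{1}(gtr0_norm k0) -normrM mulrBr [_ * grid _ _]mulrC divfK ?gt_eqF//.
rewrite ger0_norm ?subr_ge0// lerBlDr; apply: ltW; move: h2.
by rewrite intrD addrC.
Qed.

Definition cell (k : nat) (p : RR) : int * int :=
  (Num.floor (k.+1%:R * p.1), Num.floor (k.+1%:R * p.2)).
Definition node (k : nat) (s : int * int) : C :=
  ((s.1%:~R / k.+1%:R) +i* (s.2%:~R / k.+1%:R))%C.
Definition point (p : RR) : C := (p.1 +i* p.2)%C.

Lemma measurable_cell k s : measurable (cell k @^-1` [set s]).
Proof.
case: s => i j.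
have mf (l : int) : measurable ([set x : R | Num.floor (k.+1%:R * x) = l] : set (measurableTypeR R)).
  have -> : [set x : R | Num.floor (k.+1%:R * x) = l] =
     `[l%:~R / k.+1%:R, (l + 1)%:~R / k.+1%:R[%classic.
    apply/seteqP; split => x /=; rewrite in_itv/= ler_pdivrMr// ltr_pdivlMr//.
      by move=> <-; rewrite mulrC floor_itv.
    by rewrite mulrC => h; apply/eqP; rewrite floor_eq.
  exact: measurable_itv.
have -> : cell k @^-1` [set (i, j)] =
  [set x : R | Num.floor (k.+1%:R * x) = i] `*` [set x : R | Num.floor (k.+1%:R * x) = j].
  by apply/seteqP; split => -[x y] /=; rewrite /cell => -[/= -> ->].
exact: measurableX.
Qed.

Lemma cvg_node p : (fun k => node k (cell k p)) @ \oo --> point p.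
Proof.
apply/cvgrPdist_le => e /pos_complexP[r r0 ->]; near=> k.
rewrite norm_modulus lecR; apply: le_trans (modulus_le_ReIm _) _.
apply: le_trans (lerD (grid_dist k p.1) (grid_dist k p.2)) _.
rewrite [leRHS]splitr.
have : k.+1%:R^-1 <= r / 2.
  by apply: ltW; near: k; exact: (near_infty_natSinv_lt (PosNum (divr_gt0 r0 (ltr0Sn _ 1)))).
by move=> H; apply: lerD.
Unshelve. all: by end_near. Qed.

(** A continuous function is the pointwise limit of its values at the nodes of
    finer and finer grids, and these approximations depend on countably many cells.
    This gives measurability for the product sigma-algebras, whose generators are
    not stated in terms of open sets. *)
Lemma measurable_approx d (T : measurableType d) (S : nat -> countType) (V : topologicalType)
    (coords : T -> V) (f : V -> R) (D : forall k, T -> S k) (back : forall k, S k -> V) :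
  continuous f -> (forall k s, measurable (D k @^-1` [set s])) ->
  (forall x, (fun k => back k (D k x)) @ \oo --> coords x) ->
  measurable_fun setT (f \o coords).
Proof.
move=> cf mD Dx.
apply: (@measurable_realfun.measurable_fun_cvg _ _ _ _ (fun k => (f \o back k) \o D k)) => [k|x _].
  exact: measurable_countable_factor.
exact: (cvg_comp _ _ (Dx x) (cf (coords x))).
Qed.

Lemma measurable_point (f : C -> R) : continuous f -> measurable_fun setT (f \o point).
Proof.
move=> cf; apply: (@measurable_approx _ _ (fun=> (int * int)%type) C point f cell node cf).
- exact: measurable_cell.
- exact: cvg_node.
Qed.

Lemma cvg_mx (T : ptopologicalType) (U : Type) (F : set_system U) (FF : Filter F)
    m n (u : U -> 'M[T]_(m, n)) (M : 'M[T]_(m, n)) :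
  (forall i j, (fun k => u k i j) @ F --> M i j) -> u @ F --> M.
Proof.
move=> H A [P hP PA].
have K : \forall k \near F, forall i j, P i j (u k i j).
  by do 2 (apply: filter_forall => ?); exact: H (hP _ _).
by apply: filterS K => k Pk; exact: PA.
Qed.

Lemma measurable_of_real_coords n (f : 'rV[C]_n -> R) : continuous f ->
  measurable_fun setT (f \o @of_real_coords R n).
Proof.
move=> cf.
apply: (@measurable_approx _ _ (fun=> n.-tuple (int * int)) _ (@of_real_coords R n) f
  (fun k x => [tuple cell k (tnth x i) | i < n])
  (fun k s => \row_j node k (tnth s j)) cf).
- move=> k s.
  have -> : (fun x : n.-tuple RR => [tuple cell k (tnth x i) | i < n]) @^-1` [set s] =
     \bigcap_(i in [set: 'I_n]) ((@tnth n RR)^~ i @^-1` (cell k @^-1` [set tnth s i])).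
    apply/seteqP; split => x /=.
    + by move=> <- i _ /=; rewrite tnth_mktuple.
    + by move=> H; apply: eq_from_tnth => i; rewrite tnth_mktuple; exact: H.
  apply: fin_bigcap_measurable => // i _.
  rewrite -[X in measurable X]setTI; apply: measurable_tnth => //.
  exact: measurable_cell.
- move=> x; apply: cvg_mx => i j.
  rewrite mxE; under eq_fun do rewrite mxE tnth_mktuple.
  exact: cvg_node.
Qed.
End measurable_coords.

(** * The mean value inequality with a Gaussian weight *)

Section area_mean.
Variable R : realType.
Local Notation C := (C R).
Local Notation normc := (@Normc.normc R).
Local Notation RR := (measurableTypeR R * measurableTypeR R)%type.
Local Notation leb := (@lebesgue_measure R).

Lemma continuous_normc : continuous (normc : C -> R).
Proof.
move=> z; apply: continuous_real_dist => e e0.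
exists (e%:C)%C; first by rewrite lt_real_complex.
move=> w; rewrite norm_modulus lt_real_complex => zw.
exact: le_trans (modulus_dist _ _) (ltW zw).
Qed.

(** Averages the position of one side of a rectangle; [A] collects the contributions
    of the other sides, which stay fixed. *)
Lemma le_integral_average (F : R -> \bar R) (K u : R) (A : \bar R) :
  measurable_fun (setT : set (measurableTypeR R)) F ->
  (forall t : R, (0 <= F t)%E) -> (0 <= A)%E ->
  (forall t : R, u <= t <= u + 1 -> (K%:E <= F t + A)%E) ->
  (K%:E <= \int[leb]_t F t + A)%E.
Proof.
move=> mF F0; case: A => [r| |] //; last first.
  by move=> _ _; rewrite addey ?leey// -ltNye (lt_le_trans ltNy0)// integral_ge0.
rewrite lee_fin => r0 H; rewrite -leeBlDr//.
have [Kr|Kr] := leP (K - r) 0.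
  by rewrite -EFinB (@le_trans _ _ 0%E)// integral_ge0.
pose U : set (measurableTypeR R) := `[u, (u + 1)]%classic.
have mU : measurable U by exact: measurable_itv.
rewrite -EFinB; apply: (@le_trans _ _ (\int[leb]_(t in U) (K - r)%:E)%E).
  rewrite integral_cst//= lebesgue_measure_itv/= lte_fin ltrDl ltr01.
  by rewrite -EFinB -EFinM (addrC u) addrK mulr1.
apply: (@le_trans _ _ (\int[leb]_(t in U) F t)%E).
  apply: ge0_le_integral => //.
  - by move=> t _; rewrite lee_fin ltW.
  - exact: measurable_funTS.
  - by move=> t; rewrite /U/= in_itv/= => /H; rewrite EFinB leeBlDr.
by apply: ge0_subset_integral => //.
Qed.

Lemma le_integral_average2 (F : R -> \bar R) (K u v : R) (A : \bar R) :
  measurable_fun (setT : set (measurableTypeR R)) F ->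
  (forall t : R, (0 <= F t)%E) -> (0 <= A)%E ->
  (forall s t : R, u <= s <= u + 1 -> v <= t <= v + 1 -> (K%:E <= F s + F t + A)%E) ->
  (K%:E <= (\int[leb]_t F t + \int[leb]_t F t) + A)%E.
Proof.
move=> mF F0 A0 H; have I0 : (0 <= \int[leb]_t F t)%E by exact: integral_ge0.
rewrite -addeA; apply: (@le_integral_average F K u _ mF F0 (adde_ge0 I0 A0)) => s hs.
rewrite addeCA; apply: (@le_integral_average F K v _ mF F0 (adde_ge0 (F0 s) A0)) => t ht.
by rewrite addeCA addeA; exact: H hs ht.
Qed.

Lemma seg_int_le_integral (G F : R -> R) (a b : R) : cont_seg G a b ->
  measurable_fun (setT : set (measurableTypeR R)) F -> (forall x, 0 <= F x) ->
  (forall x, a <= x <= b -> 0 <= G x <= F x) ->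
  ((seg_int G a b)%:E <= \int[leb]_x (F x)%:E)%E.
Proof.
move=> cG mF F0 GF; have iG := seg_integrable cG.
rewrite /seg_int /Rintegral fineK; last exact: integrable_fin_num.
apply: (@le_trans _ _ (\int[leb]_(t in `[a, b]) (F t)%:E)%E).
  apply: ge0_le_integral => //.
  - by move=> t; rewrite /= in_itv/= lee_fin => /GF/andP[].
  - by case/integrableP : iG.
  - by apply/measurable_funTS/measurable_EFinP.
  - by move=> t; rewrite /= in_itv/= lee_fin => /GF/andP[].
apply: ge0_subset_integral => //; first exact/measurable_EFinP.
by move=> x _; rewrite lee_fin.
Qed.

(** The unnormalized Gaussian weight of the plane centred at [c]. *)
Definition gauss1 (c p : RR) : R :=
  expR (- (((p.1 : R) - c.1) ^+ 2 + ((p.2 : R) - c.2) ^+ 2) / 2).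

Lemma measurable_gauss1 c : measurable_fun setT (gauss1 c).
Proof.
apply: measurableT_comp => //; apply: measurable_funM => //.
apply: measurableT_comp => //.
by apply: measurable_funD; apply: measurable_funX; apply: measurable_funB => //.
Qed.

(** Squares of half-side [2] give exponents at most [4]. *)
Lemma gauss1_box c p : `|p.1 - c.1| <= 2 -> `|p.2 - c.2| <= 2 ->
  1 <= expR 4 * gauss1 c p.
Proof.
move=> h1 h2; rewrite /gauss1 -expRD -{1}expR0 ler_expR.
have sq (x : R) : `|x| <= 2 -> x ^+ 2 <= 4.
  by move=> xx; rewrite -[x ^+ 2]real_normK ?num_real// (_ : 4 = 2 ^+ 2) ?ler_pXn2r ?nnegrE//; ring.
have := sq _ h1; have := sq _ h2; move: (_ ^+ 2) (_ ^+ 2) => x y; lra.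
Qed.

Lemma left_range (u a : R) : u - 2 <= a <= u - 2 + 1 ->
  [/\ a < u, u - 2 <= a, `|a - u| <= 2 & 1 <= u - a].
Proof.
by move=> /andP[? ?]; split; rewrite ?ler_norml; [lra|lra|apply/andP; split; lra|lra].
Qed.

Lemma right_range (u b : R) : u + 1 <= b <= u + 1 + 1 ->
  [/\ u < b, b <= u + 2, `|b - u| <= 2 & 1 <= b - u].
Proof.
by move=> /andP[? ?]; split; rewrite ?ler_norml; [lra|lra|apply/andP; split; lra|lra].
Qed.

Lemma range_abs (u a b t : R) : u - 2 <= a -> b <= u + 2 -> a <= t <= b -> `|t - u| <= 2.
Proof. by move=> ? ? /andP[? ?]; rewrite ler_norml; apply/andP; split; lra. Qed.

(** Each side of the rectangle is moved over an interval of length one, at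
    distance between [1] and [2] from the centre; averaging the Cauchy estimate over
    the four positions gives four times the integral over a square, where the
    weight is at least [exp (- 4)]. *)
Theorem area_mean (h : C -> C) (c : RR) : (forall z, derivable h z 1) ->
  ((normc (h (point c)))%:E <=
   (expR 4)%:E * \int[@area R]_p (normc (h (point p)) * gauss1 c p)%:E)%E.
Proof.
move=> dh; case: c => x0 y0.
pose c : RR := (x0, y0).
have ch : continuous h by move=> z; have /derivable1_diffP /differentiable_continuous := dh z.
have cnh : continuous (fun z => normc (h z)).
  by move=> z; apply: continuous_comp; [exact: ch|exact: continuous_normc].
pose f (p : RR) : R := normc (h (point p)) * (expR 4 * gauss1 c p).
have mf : measurable_fun setT f.
  apply: measurable_funM; first exact: (measurable_point cnh).
  by apply: measurable_funM => //; exact: measurable_gauss1.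
have f0 p : 0 <= f p by rewrite mulr_ge0 ?modulus_ge0// mulr_ge0 ?expR_ge0.
have -> : ((expR 4)%:E * \int[@area R]_p (normc (h (point p)) * gauss1 c p)%:E =
    \int[@area R]_p (f p)%:E)%E.
  rewrite -ge0_integralZl//.
  - by apply: eq_integral => p _; rewrite -EFinM mulrCA.
  - apply/measurable_EFinP/measurable_funM; first exact: (measurable_point cnh).
    exact: measurable_gauss1.
  - by move=> p _; rewrite lee_fin mulr_ge0 ?modulus_ge0 ?expR_ge0.
have mEf : measurable_fun setT (EFin \o f) by exact/measurable_EFinP.
have Ef0 p : (0 <= (EFin \o f) p)%E by rewrite lee_fin.
pose V (x : R) : \bar R := (\int[leb]_y (f (x, y))%:E)%E.
pose H (y : R) : \bar R := (\int[leb]_x (f (x, y))%:E)%E.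
have mV : measurable_fun (setT : set (measurableTypeR R)) V by exact: (@measurable_fun_fubini_tonelli_F _ _ _ _ _ leb _ mEf Ef0).
have mH : measurable_fun (setT : set (measurableTypeR R)) H by exact: (@measurable_fun_fubini_tonelli_G _ _ _ _ _ leb _ mEf Ef0).
have V0 x : (0 <= V x)%E by apply: integral_ge0 => y _; rewrite lee_fin.
have H0 x : (0 <= H x)%E by apply: integral_ge0 => y _; rewrite lee_fin.
have IV : (\int[@area R]_p (f p)%:E = \int[leb]_x V x)%E by exact: (@fubini_tonelli1 _ _ _ _ _ leb leb _ mEf Ef0).
have IH : (\int[@area R]_p (f p)%:E = \int[leb]_x H x)%E by exact: (@fubini_tonelli2 _ _ _ _ _ leb leb _ mEf Ef0).
set I : \bar R := (\int[@area R]_p (f p)%:E)%E in IV IH *.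
have I0 : (0 <= I)%E by rewrite IV integral_ge0.
have sect1 y : measurable_fun (setT : set (measurableTypeR R)) (fun x => f (x, y)).
  by apply: measurableT_comp mf _; exact: pair2_measurable.
have sect2 x : measurable_fun (setT : set (measurableTypeR R)) (fun y => f (x, y)).
  by apply: measurableT_comp mf _; exact: pair1_measurable.
pose K : R := 4 * normc (h (point c)).
(* on the box the Gaussian weight dominates the inverse distances *)
have fbox x y (r : R) : `|x - x0| <= 2 -> `|y - y0| <= 2 -> 1 <= r ->
    0 <= normc (h (point (x, y))) / r <= f (x, y).
  move=> xx yy r1; have r0 : 0 < r by exact: lt_le_trans r1.
  apply/andP; split; first by apply: divr_ge0; [exact: modulus_ge0|exact: ltW].
  rewrite /f; apply: ler_wpM2l; first exact: modulus_ge0.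
  apply: le_trans (gauss1_box (c := c) (p := (x, y)) xx yy).
  by rewrite invf_le1.
have dq : forall z : C, z != point c -> derivable h z 1 by move=> z _; exact: dh.
have rect a b c' d : x0 - 2 <= a <= x0 - 2 + 1 -> x0 + 1 <= b <= x0 + 1 + 1 ->
    y0 - 2 <= c' <= y0 - 2 + 1 -> y0 + 1 <= d <= y0 + 1 + 1 ->
    (K%:E <= H c' + H d + (V b + V a))%E.
  move=> /left_range[xa ra ha a1] /right_range[bx rb hb b1].
  move=> /left_range[yc rc hc c1] /right_range[dy rd hd d1].
  have := cauchy_bound dq (ch (point c)) xa bx yc dy.
  rewrite -/(point c) -/K -lee_fin => /le_trans; apply.
  have hx t : a <= t <= b -> `|t - x0| <= 2 := range_abs ra rb.
  have hy t : c' <= t <= d -> `|t - y0| <= 2 := range_abs rc rd.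
  have [na nb nc nd] : [/\ a != x0, b != x0, c' != y0 & d != y0].
    by rewrite (lt_eqF xa) (lt_eqF yc) (gt_eqF bx) (gt_eqF dy).
  have ca r := cont_vertical dq (a := c') (b := d) (r := r) na.
  have cb r := cont_vertical dq (a := c') (b := d) (r := r) nb.
  have cc r := cont_horizontal dq (a := a) (b := b) (r := r) nc.
  have cd r := cont_horizontal dq (a := a) (b := b) (r := r) nd.
  rewrite /weighted_perimeter (seg_intD (cc _) (cd _)) (seg_intD (cb _) (ca _)) !EFinD.
  apply: leeD; apply: leeD.
  - apply: (seg_int_le_integral (cc _) (sect1 c')) => [x|x /hx xx]; first exact: f0.
    exact: fbox.
  - apply: (seg_int_le_integral (cd _) (sect1 d)) => [x|x /hx xx]; first exact: f0.
    exact: fbox.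
  - apply: (seg_int_le_integral (cb _) (sect2 b)) => [x|x /hy xx]; first exact: f0.
    exact: fbox.
  - apply: (seg_int_le_integral (ca _) (sect2 a)) => [x|x /hy xx]; first exact: f0.
    exact: fbox.
have IVH : (K%:E <= (I + I) + (I + I))%E.
  rewrite {1 2}IV; apply: (@le_integral_average2 V K (x0 + 1) (x0 - 2) _ mV V0 (adde_ge0 I0 I0)) => b a hb ha.
  rewrite [X in (_ <= X)%E]addeC IH; apply: (@le_integral_average2 H K (y0 - 2) (y0 + 1) _ mH H0 (adde_ge0 (V0 b) (V0 a))) => c' d hc hd.
  exact: rect.
move: IVH; rewrite /K; case: (I) I0 => [r| |]//; last by move=> *; rewrite leey.
rewrite !lee_fin => _ rr.
by rewrite -(@ler_pM2l _ 4)//; apply: le_trans rr _; rewrite le_eqVlt; apply/orP; left; apply/eqP; ring.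
Qed.
End area_mean.

Section power_sigma.
Context d (T : measurableType d) (R : realType).
Variable m : {sigma_finite_measure set T -> \bar R}.

Lemma power_step_sigma_finite n (mu : {measure set (n.-tuple T) -> \bar R}) :
  sigma_finite setT mu -> sigma_finite setT (power_step m mu).
Proof.
move=> /sigma_finiteP[A [AT ndA Aoo]].
have /sigma_finiteP[F [FT ndF Foo]] := sigma_finiteT m.
have pre k : @tuple_cons _ T n @^-1`
    ((fun x : n.+1.-tuple T => [tuple of behead x]) @^-1` (A k) `&`
     (fun x : n.+1.-tuple T => thead x) @^-1` (F k)) = A k `*` F k.
  have bh t x : [tuple of behead (@tuple_cons _ T n (t, x))] = t :> n.-tuple T by exact/val_inj.
  have th t x : thead (@tuple_cons _ T n (t, x)) = x by [].
  apply/seteqP; split => -[t x] [h1 h2]; split.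
  - by move: h1; rewrite /preimage /mkset bh.
  - by move: h2; rewrite /preimage /mkset th.
  - by rewrite /preimage /mkset bh.
  - by rewrite /preimage /mkset th.
exists (fun k => (fun x : n.+1.-tuple T => [tuple of behead x]) @^-1` (A k) `&`
     (fun x : n.+1.-tuple T => thead x) @^-1` (F k)).
  apply/seteqP; split => // x _.
  have : setT [tuple of behead x] by [].
  rewrite AT => -[i _ Ai].
  have : setT (thead x) by [].
  rewrite FT => -[j _ Fj].
  exists (maxn i j) => //; split => /=.
  - by move: Ai; exact/subsetPset/ndA/leq_maxl.
  - by move: Fj; exact/subsetPset/ndF/leq_maxr.
move=> k; have [mA Ak] := Aoo k; have [mF Fk] := Foo k; split.
  apply: measurableI.
    by rewrite -[X in measurable X]setTI; exact: measurable_behead.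
  rewrite -[X in measurable X]setTI; exact: (@measurable_tnth _ T n.+1 ord0).
rewrite /power_step /pushforward pre product_measure1E//.
by rewrite lte_mul_pinfty// ge0_fin_numE.
Qed.

Lemma power_measure_sigma_finite n : sigma_finite setT (power_measure m n).
Proof.
elim: n => [|n IH]; last exact: power_step_sigma_finite.
by exists (fun=> setT); [rewrite bigcup_const|move=> i; split => //; rewrite /= diracT ltry].
Qed.

(** An alias that carries the sigma-finite structure required by Tonelli's
    theorem. *)
Definition power_measure_fun n : set (n.-tuple T) -> \bar R := power_measure m n.
HB.instance Definition _ n := Measure.on (@power_measure_fun n).
HB.instance Definition _ n := Measure_isSigmaFinite.Build _ _ _
  (@power_measure_fun n) (@power_measure_sigma_finite n).

(** The first coordinate of a tuple is integrated innermost, as the power measure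
    is the image of a product under consing. *)
Lemma power_measure_tonelli n (g : n.+1.-tuple T -> \bar R) :
  measurable_fun setT g -> (forall x, (0 <= g x)%E) ->
  measurable_fun setT (fun t : n.-tuple T => (\int[m]_x g [tuple of x :: t])%E) /\
  (\int[power_measure m n.+1]_x g x =
   \int[power_measure m n]_t \int[m]_x g [tuple of x :: t])%E.
Proof.
move=> mg g0.
have mgc : measurable_fun setT (g \o @tuple_cons _ T n).
  exact: measurableT_comp (@measurable_tuple_cons _ T n).
have gc0 x : (0 <= (g \o @tuple_cons _ T n) x)%E by exact: g0.
split; first exact: (@measurable_fun_fubini_tonelli_F _ _ _ _ _ m _ mgc gc0).
rewrite /= ge0_integral_pushforward//; last exact: measurable_tuple_cons.
rewrite preimage_setT.
exact: (@fubini_tonelli1 _ _ _ _ _ (@power_measure_fun n) m _ mgc gc0).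
Qed.
End power_sigma.

Section row_cons.
Variable K : numFieldType.

(** Row vectors as pairs of a first coordinate and the rest; freezing either
    component preserves differentiability. *)
Definition row_cons n (z : K) (w : 'rV[K]_n) : 'rV[K]_n.+1 :=
  \row_j (if unlift ord0 j is Some k then w 0 k else z).

Definition row_shift n (w : 'rV[K]_n) : 'rV[K]_n.+1 := row_cons 0 w.

Lemma row_shift_linear n : linear (@row_shift n).
Proof.
move=> a u v; apply/rowP => j; rewrite !mxE.
by case: unlift => [k|]; rewrite ?mxE// mulr0 addr0.
Qed.
HB.instance Definition _ n := GRing.isLinear.Build _ _ _ _ (@row_shift n) (@row_shift_linear n).

Lemma row_shift_continuous n : continuous (@row_shift n).
Proof.
move=> w; apply: (@cvg_mx _ _ _ (nbhs_filter w)) => i j.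
rewrite mxE; under eq_fun do rewrite mxE.
by case: unlift => [k|]; [exact: coord_continuous|exact: cvg_cst].
Qed.

Lemma row_consE n z (w : 'rV[K]_n) : row_cons z w = z *: row_cons 1 0 + row_shift w.
Proof.
apply/rowP => j; rewrite !mxE.
by case: unlift => [k|]; rewrite ?mxE ?mulr0 ?add0r ?mulr1 ?addr0.
Qed.

Lemma derivable_row_cons n (f : 'rV[K]_n.+1 -> K) (w : 'rV[K]_n) z :
  (forall x, differentiable f x) -> derivable (fun z => f (row_cons z w)) z 1.
Proof.
move=> df; apply/derivable1_diffP.
apply: (@differentiable_comp _ _ _ _ (fun z => row_cons z w) f) => //.
rewrite [X in differentiable X _](_ : _ = (fun z => z *: row_cons 1 0 + row_shift w)).
  by apply: differentiableD => //; apply: differentiableZl.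
by apply/funext => u; rewrite row_consE.
Qed.

Lemma differentiable_row_cons n (f : 'rV[K]_n.+1 -> K) (w : 'rV[K]_n) z :
  (forall x, differentiable f x) -> differentiable (fun w => f (row_cons z w)) w.
Proof.
move=> df.
apply: (@differentiable_comp _ _ _ _ (fun w => row_cons z w) f) => //.
rewrite [X in differentiable X _](_ : _ = (fun w => z *: row_cons 1 0 + row_shift w)).
  by apply: differentiableD => //; apply: linear_differentiable; exact: row_shift_continuous.
by apply/funext => u; rewrite row_consE.
Qed.
End row_cons.

Section volume.
Variable R : realType.
Local Notation C := (C R).
Local Notation normc := (@Normc.normc R).
Local Notation RR := (measurableTypeR R * measurableTypeR R)%type.

Lemma of_real_coords_cons n (p : RR) (t : n.-tuple RR) :
  of_real_coords [tuple of p :: t] = row_cons (point p) (of_real_coords t).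
Proof.
apply/rowP => j; rewrite !mxE; case: unliftP => [k|] ->.
  by rewrite tnthS mxE.
by rewrite tnth0.
Qed.

Definition gauss n (c x : n.-tuple RR) : R := \prod_(i < n) gauss1 (tnth c i) (tnth x i).

Lemma gauss_cons n (p q : RR) (c t : n.-tuple RR) :
  gauss [tuple of p :: c] [tuple of q :: t] = gauss1 p q * gauss c t.
Proof.
rewrite /gauss big_ord_recl !tnth0; congr (_ * _).
by apply: eq_bigr => i _; rewrite !tnthS.
Qed.

Lemma gauss_ge0 n (c x : n.-tuple RR) : 0 <= gauss c x.
Proof. by apply: prodr_ge0 => i _; exact: expR_ge0. Qed.

Lemma measurable_gauss n (c : n.-tuple RR) : measurable_fun setT (gauss c).
Proof.
apply: measurable_prod => i _.
apply: (@measurableT_comp _ _ _ _ _ _ (gauss1 (tnth c i))); first exact: measurable_gauss1.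
exact: measurable_tnth.
Qed.

(** The total mass of the normal density. *)
Lemma gauss_line_integral (a : R) :
  (\int[@lebesgue_measure R]_x (expR (- (x - a) ^+ 2 / 2))%:E = (Num.sqrt (2 * pi))%:E)%E.
Proof.
have s0 : 0 < Num.sqrt (2 * pi) :> R by rewrite sqrtr_gt0 mulr_gt0// pi_gt0.
have := integral_normal_pdf a 1.
have E x : normal_pdf a 1 x = (Num.sqrt (2 * pi))^-1 * expR (- (x - a) ^+ 2 / 2).
  rewrite normal_pdfE ?oner_eq0// /normal_peak /normal_fun expr1n mul1r.
  by rewrite mulr_natl.
under eq_integral do rewrite E EFinM.
rewrite ge0_integralZl//.
- move=> H; rewrite -[LHS]mul1e -[X in (X%:E * _)%E](divff (lt0r_neq0 s0)) EFinM -muleA H.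
  by rewrite mule1.
- apply/measurable_EFinP.
  have := @measurable_normal_fun R a 1; congr measurable_fun.
  by apply/funext => x; rewrite /normal_fun expr1n.
Qed.

Lemma gauss1_integral (c : RR) : (\int[@area R]_p (gauss1 c p)%:E = (2 * pi)%:E)%E.
Proof.
have mf : measurable_fun setT (EFin \o gauss1 c).
  by apply/measurable_EFinP; exact: measurable_gauss1.
have f0 p : (0 <= (EFin \o gauss1 c) p)%E by rewrite lee_fin expR_ge0.
rewrite [LHS](@fubini_tonelli1 _ _ _ _ _ (@lebesgue_measure R) (@lebesgue_measure R) _ mf f0).
rewrite /fubini_F.
have ml (a : R) : measurable_fun (setT : set (measurableTypeR R))
    (fun x => (expR (- (x - a) ^+ 2 / 2))%:E).
  apply/measurable_EFinP.
  have := @measurable_normal_fun R a 1; congr measurable_fun.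
  by apply/funext => x; rewrite /normal_fun expr1n.
have s0 : 0 <= Num.sqrt (2 * pi) :> R by [].
under eq_integral => x _.
  under eq_integral => y _.
    rewrite /= /gauss1/= opprD mulrDl expRD EFinM.
    over.
  rewrite ge0_integralZl//.
  rewrite gauss_line_integral muleC.
  over.
rewrite ge0_integralZl//.
by rewrite gauss_line_integral -EFinM -expr2 sqr_sqrtr// mulr_ge0// pi_ge0.
Qed.

Lemma gauss_integral n (c : n.-tuple RR) :
  (\int[volume R n]_x (gauss c x)%:E = ((2 * pi) ^+ n)%:E)%E.
Proof.
elim: n c => [|n IH] c.
  rewrite /volume /= integral_dirac//; last by apply/measurable_EFinP; exact: measurable_gauss.
  by rewrite diracT mul1e /gauss big_ord0 expr0.
pose F := EFin \o gauss c.
have mF : measurable_fun setT F by apply/measurable_EFinP; exact: measurable_gauss.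
have F0 x : (0 <= F x)%E by rewrite lee_fin gauss_ge0.
have [_ ->] := power_measure_tonelli (@area R) mF F0.
pose c0 : RR := thead c; pose c1 : n.-tuple RR := [tuple of behead c].
have cE : c = [tuple of c0 :: c1] by exact: tuple_eta.
have FE (t : n.-tuple RR) (p : RR) : F [tuple of p :: t] = ((gauss c1 t)%:E * (gauss1 c0 p)%:E)%E.
  by rewrite /F /= [in gauss c _]cE gauss_cons mulrC EFinM.
have inner (t : n.-tuple RR) : (\int[@area R]_p F [tuple of p :: t] = (2 * pi)%:E * (gauss c1 t)%:E)%E.
  under eq_integral do rewrite FE.
  rewrite ge0_integralZl//.
  - by rewrite gauss1_integral muleC.
  - by apply/measurable_EFinP; exact: measurable_gauss1.
  - by move=> *; rewrite ?lee_fin ?gauss_ge0 ?expR_ge0.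
  - by rewrite ?lee_fin gauss_ge0.
under eq_integral do rewrite inner.
rewrite ge0_integralZl//; last 3 first.
- by apply/measurable_EFinP; exact: measurable_gauss.
- by move=> p _; rewrite lee_fin gauss_ge0.
- by rewrite ?lee_fin mulr_ge0// pi_ge0.
by rewrite [X in (_ * X)%E]IH -EFinM exprS.
Qed.

Lemma continuous_normc_comp n (f : 'rV[C]_n -> C) :
  (forall x, differentiable f x) -> continuous (fun x => normc (f x)).
Proof.
move=> df x; apply: continuous_comp; last exact: continuous_normc.
exact: differentiable_continuous (df x).
Qed.

(** Induction on the dimension: the planar inequality in the first coordinate,
    the induction hypothesis in the others. *)
Theorem volume_mean n (f : 'rV[C]_n -> C) (c : n.-tuple RR) :
  (forall x, differentiable f x) ->
  ((normc (f (of_real_coords c)))%:E <= (expR 4 ^+ n)%:E *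
    \int[volume R n]_x (normc (f (of_real_coords x)) * gauss c x)%:E)%E.
Proof.
elim: n f c => [|n IH] f c df.
  have mF : measurable_fun setT (fun x : 0.-tuple RR => normc (f (of_real_coords x)) * gauss c x).
    apply: measurable_funM; last exact: measurable_gauss.
    exact: (measurable_of_real_coords (continuous_normc_comp df)).
  rewrite /volume /= integral_dirac//; last exact/measurable_EFinP.
  rewrite diracT ?expr0 !mul1e /gauss big_ord0 mulr1.
  by rewrite (tuple0 c) lexx.
pose F (x : n.+1.-tuple RR) := normc (f (of_real_coords x)) * gauss c x.
have mF : measurable_fun setT F.
  apply: measurable_funM; last exact: measurable_gauss.
  exact: (measurable_of_real_coords (continuous_normc_comp df)).
have F0 x : 0 <= F x by apply: mulr_ge0; [exact: modulus_ge0|exact: gauss_ge0].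
have [mI ->] := @power_measure_tonelli _ _ R (@area R) n (EFin \o F)
   ltac:(exact/measurable_EFinP) (fun x => ltac:(by rewrite lee_fin)).
pose c0 : RR := thead c; pose c1 : n.-tuple RR := [tuple of behead c].
have cE : c = [tuple of c0 :: c1] by exact: tuple_eta.
rewrite cE of_real_coords_cons.
apply: le_trans (IH (fun w => f (row_cons (point c0) w)) c1 _) _.
  by move=> x; exact: differentiable_row_cons.
rewrite exprS [(expR 4 * _)]mulrC EFinM -muleA.
apply: lee_wpmul2l; first by rewrite lee_fin exprn_ge0// expR_ge0.
pose G (t : n.-tuple RR) := (\int[@area R]_p (EFin \o F) [tuple of p :: t])%E.
have mI' : measurable_fun setT G by exact: mI.
have G0 t : (0 <= G t)%E by apply: integral_ge0 => p _; rewrite /= lee_fin.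
have GE t : G t = ((gauss c1 t)%:E * \int[@area R]_p
    (normc (f (row_cons (point p) (of_real_coords t))) * gauss1 c0 p)%:E)%E.
  rewrite -ge0_integralZl//.
  - apply: eq_integral => p _.
    by rewrite /= -EFinM /F [in gauss c _]cE gauss_cons of_real_coords_cons; congr EFin;
       rewrite [LHS]mulrA [LHS]mulrC.
  - apply/measurable_EFinP/measurable_funM; last exact: measurable_gauss1.
    apply: (measurable_point (f := fun z => normc (f (row_cons z (of_real_coords t))))) => z.
    apply: (@continuous_comp _ _ _ (fun z => f (row_cons z (of_real_coords t)))).
      apply: differentiable_continuous; apply/derivable1_diffP.
      exact: derivable_row_cons.
    exact: continuous_normc.
  - by move=> p _; rewrite lee_fin; apply: mulr_ge0; [exact: modulus_ge0|exact: expR_ge0].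
  - by rewrite ?lee_fin gauss_ge0.
rewrite -ge0_integralZl//.
apply: ge0_le_integral => //.
- by move=> t _; rewrite lee_fin; apply: mulr_ge0; [exact: modulus_ge0|exact: gauss_ge0].
- apply/measurable_EFinP/measurable_funM; last exact: measurable_gauss.
  apply: (measurable_of_real_coords (f := fun w => normc (f (row_cons (point c0) w)))).
  by apply: continuous_normc_comp => x; exact: differentiable_row_cons.
- by apply: measurable_funeM.
- move=> t _; rewrite -/(G t) GE muleCA mulrC EFinM.
  apply: lee_wpmul2l; first by rewrite lee_fin gauss_ge0.
  apply: (area_mean (h := fun z => f (row_cons z (of_real_coords t)))) => z.
  exact: derivable_row_cons.
- by move=> t _; exact: G0.
Qed.
End volume.

(** * The complex exponential *)

Section cexp.
Variable R : realType.
Local Notation C := (C R).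
Local Notation normc := (@Normc.normc R).

Definition cexp (z : C) : C :=
  ((expR (complex.Re z) * cos (complex.Im z)) +i* (expR (complex.Re z) * sin (complex.Im z)))%C.

Lemma cexpD z w : cexp (z + w) = cexp z * cexp w.
Proof.
case: z w => a b [c d]; rewrite /cexp /=; simpc.
by rewrite expRD cosD sinD; congr (_ +i* _)%C; ring.
Qed.

Lemma normc_cexp z : normc (cexp z) = expR (complex.Re z).
Proof.
case: z => a b /=; rewrite !exprMn -mulrDr cos2Dsin2 mulr1.
by rewrite sqrtr_sqr ger0_norm// expR_ge0.
Qed.

(** From the expansions of the real exponential, cosine and sine at [0]. *)
Lemma cexp_eps0 (e : R) : 0 < e -> exists2 d : R, 0 < d & forall z,
  normc z < d -> normc (cexp z - 1 - z) <= e * normc z.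
Proof.
(* for [e <= 1] the real exponential stays below [3] near [0] *)
wlog e1 : e / e <= 1.
  move=> H e0; have [|d d0 Hd] := H (Num.min e 1) _ ltac:(by rewrite lt_min e0 ltr01).
    by rewrite ge_min lexx orbT.
  exists d => // z /Hd /le_trans; apply.
  by rewrite ler_wpM2r ?modulus_ge0// ge_min lexx.
move=> e0; have e4 : 0 < e / 16 by rewrite divr_gt0.
have [d1 d10 H1] := derivable_dist (@ex_derive _ _ _ _ _ _ _ (is_derive_expR (0 : R))) e4.
have [d2 d20 H2] := derivable_dist (@ex_derive _ _ _ _ _ _ _ (is_derive_cos (0 : R))) e4.
have [d3 d30 H3] := derivable_dist (@ex_derive _ _ _ _ _ _ _ (is_derive_sin (0 : R))) e4.
rewrite !derive_val in H1 H2 H3.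
exists (Num.min (Num.min d1 d2) (Num.min d3 (Num.min (e / 16) 1))).
  by rewrite !lt_min d10 d20 d30 e4 ltr01.
move=> z; rewrite !lt_min => /andP[/andP[z1 z2] /andP[z3 /andP[z4 z5]]].
have ha := Re_le_modulus z; have hb := Im_le_modulus z.
have := H1 (complex.Re z); have := H2 (complex.Im z); have := H3 (complex.Im z).
rewrite !subr0 !sub0r !normrN cos0 sin0 expR0 !subr0 oppr0 !mul0r subr0 !mul1r.
move=> /(_ (le_lt_trans hb z3)) K3 /(_ (le_lt_trans hb z2)) K2 /(_ (le_lt_trans ha z1)) K1.
apply: le_trans (modulus_le_ReIm _) _.
move: K1 K2 K3 ha hb z4 z5 {z1 z2 z3 H1 H2 H3}; set r := normc z.
rewrite {1 2}/cexp; case: z @r => a b r.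
have -> : complex.Re ((expR a * cos b +i* (expR a * sin b))%C - 1 - (a +i* b)%C : C) =
  expR a * (cos b - 1) + (expR a - 1 - a) by simpc => /=; ring.
have -> : complex.Im ((expR a * cos b +i* (expR a * sin b))%C - 1 - (a +i* b)%C : C) =
  expR a * (sin b - b) + (expR a - 1) * b by simpc => /=; ring.
rewrite /=; move: (expR_ge0 a); move: (expR a) (cos b) (sin b) => E c s E0 K1 K2 K3 ha hb r1 r2.
have r0 : 0 <= r by exact: modulus_ge0.
have er0 : 0 <= e / 16 * r by rewrite mulr_ge0// ltW.
have er1 : e / 16 * r <= r / 16 by rewrite mulrAC -[leRHS]mul1r mulrA ler_pM2r// ler_wpM2r.
have K1' : `|E - 1 - a| <= e / 16 * r by apply: le_trans K1 _; rewrite ler_wpM2l// ltW.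
have K2' : `|c - 1| <= e / 16 * r by apply: le_trans K2 _; rewrite ler_wpM2l// ltW.
have K3' : `|s - b| <= e / 16 * r by apply: le_trans K3 _; rewrite ler_wpM2l// ltW.
have EB : `|E - 1| <= 17 / 16 * r.
  have -> : E - 1 = (E - 1 - a) + a by ring.
  by apply: le_trans (ler_normD _ _) _; lra.
have E3 : E <= 3 by have := ler_norm (E - 1); lra.
have B1 : `|E * (c - 1)| <= 3 * (e / 16 * r) by rewrite normrM ger0_norm// ler_pM.
have B2 : `|E * (s - b)| <= 3 * (e / 16 * r) by rewrite normrM ger0_norm// ler_pM.
have B3 : `|(E - 1) * b| <= 17 / 16 * (e / 16 * r).
  rewrite normrM mulrA; apply: ler_pM => //; apply: le_trans EB _.
  by rewrite ler_wpM2l// ltW.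
have := ler_normD (E * (c - 1)) (E - 1 - a).
have := ler_normD (E * (s - b)) ((E - 1) * b).
have : e * r = 16 * (e / 16 * r) by field.
lra.
Qed.

Lemma derivable_cexp z : derivable cexp z 1.
Proof.
apply: ex_derive; apply: (@dist_is_derive _ _ _ (cexp z)) => e /pos_complexP[r r0 ->].
have c0 : 0 < normc (cexp z) by rewrite normc_cexp expR_gt0.
have [d d0 H] := cexp_eps0 (divr_gt0 r0 c0).
exists (d%:C)%C; first by rewrite lt_real_complex.
move=> w; rewrite !norm_modulus -rmorphM lt_real_complex lecR -modulusN opprB => /H.
have -> : cexp w - cexp z - cexp z * (w - z) = cexp z * (cexp (w - z) - 1 - (w - z)).
  have -> : cexp w = cexp z * cexp (w - z) by rewrite -cexpD addrC subrK.
  by rewrite [RHS]mulrBr [in RHS]mulrBr mulr1.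
move=> K1; rewrite Normc.normcM mulrC.
by rewrite -ler_pdivlMr// mulrAC.
Qed.
End cexp.

(** * Point evaluations and kernels of the Fock space *)

Section fock.
Variables (R : realType) (n : nat).
Local Notation C := (C R).
Local Notation normc := (@Normc.normc R).
Local Notation RR := (measurableTypeR R * measurableTypeR R)%type.
Local Notation V := 'rV[C]_n.
Implicit Types (z w u c : V) (f g : V -> C).

Definition sqnorm z : R := \sum_j (complex.Re (z 0 j) ^+ 2 + complex.Im (z 0 j) ^+ 2).

Lemma sqnorm_ge0 z : 0 <= sqnorm z.
Proof. by apply: sumr_ge0 => j _; rewrite addr_ge0 ?sqr_ge0. Qed.

Lemma Re_inner z w : complex.Re (inner_prod z w) =
  \sum_j (complex.Re (z 0 j) * complex.Re (w 0 j) + complex.Im (z 0 j) * complex.Im (w 0 j)).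
Proof.
rewrite /inner_prod (big_morph (@complex.Re R) (id1 := 0) (op1 := +%R)) //; last first.
  by move=> [a b] [a' b'].
apply: eq_bigr => j _; case: (z 0 j) => a b; case: (w 0 j) => a' b'; simpc => /=; ring.
Qed.

Lemma Re_inner_self z : complex.Re (inner_prod z z) = sqnorm z.
Proof. by rewrite Re_inner; apply: eq_bigr => j _; rewrite !expr2. Qed.

Lemma euclid_normE z : euclid_norm z ^+ 2 = sqnorm z.
Proof. by rewrite /euclid_norm Re_inner_self sqr_sqrtr// sqnorm_ge0. Qed.

Lemma sqnormB z w : sqnorm (z - w) = sqnorm z + sqnorm w - 2 * complex.Re (inner_prod z w).
Proof.
rewrite Re_inner mulr_sumr -big_split/= -sumrB; apply: eq_bigr => j _.
rewrite !mxE; case: (z 0 j) => a b; case: (w 0 j) => a' b'; simpc => /=; ring.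
Qed.

Lemma Re_innerNr z w : complex.Re (inner_prod z (- w)) = - complex.Re (inner_prod z w).
Proof.
rewrite !Re_inner -sumrN; apply: eq_bigr => j _; rewrite !mxE.
by case: (w 0 j) => a b /=; rewrite !mulrN opprD.
Qed.

Lemma Re_innerDr z w u : complex.Re (inner_prod z (w + u)) =
  complex.Re (inner_prod z w) + complex.Re (inner_prod z u).
Proof.
rewrite !Re_inner -big_split; apply: eq_bigr => j _; rewrite !mxE.
case: (z 0 j) (w 0 j) (u 0 j) => a b [a' b'] [a'' b''] /=; ring.
Qed.

Definition to_real_coords z : n.-tuple RR :=
  [tuple (complex.Re (z 0 j), complex.Im (z 0 j)) : RR | j < n].

Lemma to_real_coordsK z : of_real_coords (to_real_coords z) = z.
Proof. by apply/rowP => j; rewrite !mxE tnth_mktuple /=; case: (z 0 j). Qed.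

Lemma gaussE c (x : n.-tuple RR) :
  gauss (to_real_coords c) x = expR (- sqnorm (of_real_coords x - c) / 2).
Proof.
rewrite /gauss -expR_sum; congr expR; rewrite /sqnorm -sumrN mulr_suml.
apply: eq_bigr => j _; rewrite !mxE tnth_mktuple /=.
by case: (c 0 j) => a b; simpc.
Qed.

(** The reproducing kernel of the Fock space at [u]. *)
Definition kern u z : C := cexp (inner_prod z u / 2).

Lemma normc_kern u z : normc (kern u z) = expR (complex.Re (inner_prod z u) / 2).
Proof.
rewrite normc_cexp; congr expR.
rewrite (_ : (2 : C)^-1 = ((2^-1 : R)%:C)%C); last by rewrite rmorphV ?unitfE// rmorphMn.
by rewrite ReM_real.
Qed.

Lemma differentiable_kern u z : differentiable (kern u) z.
Proof.
have -> : kern u = @cexp R \o (fun z : V => \sum_j z 0 j * (((u 0 j)^*)%C / 2) + 0).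
  apply/funext => w; rewrite /kern /inner_prod /= addr0 mulr_suml; congr (@cexp R).
  by apply: eq_bigr => j _; rewrite mulrA.
apply: differentiable_comp; first exact: differentiable_dot.
by apply/derivable1_diffP; exact: derivable_cexp.
Qed.
Definition fock_density f (x : n.-tuple RR) : R :=
  normc (f (of_real_coords x)) ^+ 2 * expR (- sqnorm (of_real_coords x) / 2).

Lemma fock_sqnormE f : fock_sqnorm f =
  (((2 * pi)^-1 ^+ n)%:E * \int[volume R n]_x (fock_density f x)%:E)%E.
Proof.
rewrite /fock_sqnorm; congr (_ * _)%E; apply: eq_integral => x _.
by rewrite euclid_normE.
Qed.

Lemma fock_density_ge0 f x : 0 <= fock_density f x.
Proof. by apply: mulr_ge0; [exact: exprn_ge0 (modulus_ge0 _)|exact: expR_ge0]. Qed.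

Lemma gauss0 (x : n.-tuple RR) :
  gauss (to_real_coords 0) x = expR (- sqnorm (of_real_coords x) / 2).
Proof. by rewrite gaussE subr0. Qed.

Lemma measurable_fock_density f : holomorphic f -> measurable_fun setT (fock_density f).
Proof.
move=> hf; apply: measurable_funM.
  apply: measurable_funX.
  exact: (measurable_of_real_coords (continuous_normc_comp hf)).
rewrite (_ : (fun _ => _) = gauss (to_real_coords 0)); first exact: measurable_gauss.
by apply/funext => x; rewrite gauss0.
Qed.

Lemma two_pi_gt0 : 0 < (2 * pi)^-1 ^+ n :> R.
Proof. by rewrite exprn_gt0// invr_gt0 mulr_gt0// pi_gt0. Qed.

Lemma fock_sqnorm_ge0 f : (0 <= fock_sqnorm f)%E.
Proof.
rewrite fock_sqnormE mule_ge0//; first by rewrite lee_fin ltW// two_pi_gt0.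
by apply: integral_ge0 => x _; rewrite lee_fin fock_density_ge0.
Qed.

Lemma fock_norm_ge0 f : 0 <= fock_norm f.
Proof. exact: sqrtr_ge0. Qed.

Lemma fock_norm_sqr f : fock_space f -> ((fock_norm f ^+ 2)%:E = fock_sqnorm f)%E.
Proof.
move=> [_ fin]; have f0 := fock_sqnorm_ge0 f.
rewrite /fock_norm sqr_sqrtr ?fine_ge0// fineK// ge0_fin_numE//.
Qed.

(** The constant of the mean value inequality times the normalization of the
    measure. *)
Definition eval_const : R := (expR 4 * (2 * pi)) ^+ n.

Lemma eval_const_gt0 : 0 < eval_const.
Proof. by rewrite exprn_gt0// !mulr_gt0// ?expR_gt0// pi_gt0. Qed.

(** The mean value inequality at [c] for the square of [f * kern (- c)].  The modulus
    of that square times the Gaussian centred at [c] is the Fock density of [f] up to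
    the factor [exp (- |c|^2 / 2)], by the identity
    [|z - c|^2 + 2 Re <z, c> = |z|^2 + |c|^2]. *)
Theorem fock_eval f c : fock_space f ->
  normc (f c) ^+ 2 <= eval_const * expR (sqnorm c / 2) * fock_norm f ^+ 2.
Proof.
move=> Hf; have [hf _] := Hf.
have dF z : differentiable (fun w => f w * kern (- c) w * (f w * kern (- c) w)) z.
  by apply: differentiable_sqr_mul; [exact: hf|exact: differentiable_kern].
have := volume_mean (to_real_coords c) dF.
rewrite to_real_coordsK.
have nF z : normc (f z * kern (- c) z * (f z * kern (- c) z)) =
    normc (f z) ^+ 2 * expR (- complex.Re (inner_prod z c)).
  rewrite !Normc.normcM normc_kern Re_innerNr mulrACA -expr2 -expRD.
  by rewrite -splitr.
rewrite nF Re_inner_self.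
have -> : (\int[volume R n]_x (normc (f (of_real_coords x) * kern (- c) (of_real_coords x) *
     (f (of_real_coords x) * kern (- c) (of_real_coords x))) * gauss (to_real_coords c) x)%:E =
   (expR (- sqnorm c / 2))%:E * \int[volume R n]_x (fock_density f x)%:E)%E.
  rewrite -ge0_integralZl//.
  - apply: eq_integral => x _; rewrite nF gaussE sqnormB -EFinM /fock_density; congr EFin.
    rewrite -mulrA -expRD [RHS]mulrCA -expRD; congr (_ * expR _).
    by field.
  - by apply/measurable_EFinP; exact: measurable_fock_density.
  - by move=> x _; rewrite lee_fin fock_density_ge0.
have fn := fock_norm_sqr Hf; move: fn; rewrite fock_sqnormE.
have k0 := two_pi_gt0.
have I0 : (0 <= \int[volume R n]_x (fock_density f x)%:E)%E.
  by apply: integral_ge0 => x _; rewrite lee_fin fock_density_ge0.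
case: (\int[volume R n]_x (fock_density f x)%:E)%E I0 => [i| |]//; last first.
  by rewrite gt0_muley.
rewrite lee_fin => i0 [fn]; rewrite -!EFinM lee_fin => H.
rewrite fn -(@ler_pM2r _ (expR (- sqnorm c))) ?expR_gt0//; apply: le_trans H _.
rewrite /eval_const exprMn exprVn le_eqVlt; apply/orP; left; apply/eqP.
have -> : expR (- sqnorm c / 2) = expR (sqnorm c / 2) * expR (- sqnorm c).
  by rewrite -expRD; congr expR; field.
have p0 : (2 * pi) ^+ n != 0 :> R by rewrite expf_neq0// mulf_neq0// gt_eqF ?pi_gt0.
by field.
Qed.

(** Completing the square turns the Fock density of a kernel into a Gaussian
    centred at [u]. *)
Lemma fock_kern u : fock_space (kern u) /\ fock_norm (kern u) ^+ 2 = expR (sqnorm u / 2).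
Proof.
have E : fock_sqnorm (kern u) = (expR (sqnorm u / 2))%:E.
  rewrite fock_sqnormE.
  have -> : (\int[volume R n]_x (fock_density (kern u) x)%:E =
      (expR (sqnorm u / 2))%:E * \int[volume R n]_x (gauss (to_real_coords u) x)%:E)%E.
    rewrite -ge0_integralZl//.
    - apply: eq_integral => x _; rewrite gaussE sqnormB -EFinM /fock_density; congr EFin.
      rewrite normc_kern expr2 -!expRD; congr expR; by field.
    - by apply/measurable_EFinP; exact: measurable_gauss.
    - by move=> x _; rewrite lee_fin gauss_ge0.
  rewrite gauss_integral -!EFinM; congr EFin.
  rewrite mulrCA exprVn mulVf ?mulr1// expf_neq0// mulf_neq0// gt_eqF ?pi_gt0//.
have F : fock_space (kern u).
  by split; [exact: differentiable_kern|rewrite E ltry].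
by split => //; have := fock_norm_sqr F; rewrite E => -[].
Qed.

Lemma fock_sqnorm_fin f :
  (fock_sqnorm f < +oo)%E <-> (\int[volume R n]_x (fock_density f x)%:E < +oo)%E.
Proof.
have I0 : (0 <= \int[volume R n]_x (fock_density f x)%:E)%E.
  by apply: integral_ge0 => x _; rewrite lee_fin fock_density_ge0.
rewrite fock_sqnormE; move: I0; case: (\int[volume R n]_x _)%E => [i| |]//.
- by rewrite -EFinM !ltry.
- by rewrite gt0_muley// lte_fin two_pi_gt0.
Qed.

Lemma fock_space_subZ f g (a : C) : fock_space f -> fock_space g ->
  fock_space (f - a *: g).
Proof.
move=> [hf ff] [hg gg].
have hfg : holomorphic (f - a *: g).
  move=> z; apply: differentiableB; first exact: hf.
  apply: differentiableZ; exact: hg.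
split => //.
have dom x : fock_density (f - a *: g) x <=
    2 * fock_density f x + (2 * normc a ^+ 2) * fock_density g x.
  rewrite /fock_density ![_ * (_ * expR _)]mulrA -mulrDl ler_wpM2r ?expR_ge0//.
  have : normc ((f - a *: g) (of_real_coords x)) <=
      normc (f (of_real_coords x)) + normc a * normc (g (of_real_coords x)).
    by rewrite -Normc.normcM -[X in _ <= _ + X]modulusN; exact: le_normcD.
  move: (modulus_ge0 ((f - a *: g) (of_real_coords x))).
  move: (normc _) (normc (f _)) (normc a) (normc (g _)) => p q r s p0 pq.
  apply: le_trans (_ : (q + r * s) ^+ 2 <= _).
    by rewrite ler_pXn2r// nnegrE// (le_trans p0).
  rewrite -subr_ge0 (_ : _ - _ = (q - r * s) ^+ 2); last by ring.
  exact: sqr_ge0.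
have mf := measurable_fock_density hf; have mg := measurable_fock_density hg.
apply/fock_sqnorm_fin.
have k0 : 0 <= 2 * normc a ^+ 2 by rewrite mulr_ge0// exprn_ge0// modulus_ge0.
apply: (@le_lt_trans _ _ (\int[volume R n]_x
   (2%:E * (fock_density f x)%:E + (2 * normc a ^+ 2)%:E * (fock_density g x)%:E))%E).
  apply: ge0_le_integral => //.
  - by move=> x _; rewrite lee_fin fock_density_ge0.
  - by apply/measurable_EFinP; exact: measurable_fock_density.
  - by apply: emeasurable_funD; apply: measurable_funeM; apply/measurable_EFinP.
  - by move=> x _; rewrite -!EFinM -EFinD lee_fin.
rewrite ge0_integralD//; last 4 first.
- by move=> x _; rewrite mule_ge0// lee_fin fock_density_ge0.
- by apply: measurable_funeM; apply/measurable_EFinP.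
- by move=> x _; rewrite mule_ge0// lee_fin// fock_density_ge0.
- by apply: measurable_funeM; apply/measurable_EFinP.
have nn h : forall x, setT x -> (0 <= (fock_density h x)%:E)%E.
  by move=> x _; rewrite lee_fin fock_density_ge0.
rewrite !ge0_integralZl//; try exact: nn; try by apply/measurable_EFinP.
have fin h : (fock_sqnorm h < +oo)%E ->
    (\int[volume R n]_x (fock_density h x)%:E)%E \is a fin_num.
  by move=> /fock_sqnorm_fin; rewrite ge0_fin_numE//; apply: integral_ge0; exact: nn.
by rewrite lte_add_pinfty// ltey_eq fin_numM// fin.
Qed.
End fock.

(** * The symbol of a bounded composition operator *)

Section sqnorm_theory.
Variables (R : realType) (n : nat).
Local Notation C := (C R).
Local Notation normc := (@Normc.normc R).
Local Notation V := 'rV[C]_n.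
Implicit Types (z w u c : V).

Lemma modulus_sqr (x : C) : normc x ^+ 2 = complex.Re x ^+ 2 + complex.Im x ^+ 2.
Proof. by case: x => a b /=; rewrite sqr_sqrtr// addr_ge0 ?sqr_ge0. Qed.

Lemma sqnorm_normc z : sqnorm z = \sum_j normc (z 0 j) ^+ 2.
Proof. by apply: eq_bigr => j _; rewrite modulus_sqr. Qed.

Lemma modulus_coord_le z j : normc (z 0 j) ^+ 2 <= sqnorm z.
Proof.
rewrite sqnorm_normc (bigD1 j)//= lerDl; apply: sumr_ge0 => i _; exact: exprn_ge0 (modulus_ge0 _).
Qed.

Lemma sqnormZ (a : C) z : sqnorm (a *: z) = normc a ^+ 2 * sqnorm z.
Proof.
rewrite !sqnorm_normc mulr_sumr; apply: eq_bigr => j _.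
by rewrite mxE Normc.normcM exprMn.
Qed.

Lemma sqnorm_eq0 z : sqnorm z <= 0 -> z = 0.
Proof.
move=> z0; apply/rowP => j; rewrite mxE; apply: Normc.eq0_normc.
apply/eqP; rewrite -sqrf_eq0 eq_le exprn_ge0 ?modulus_ge0// andbT.
exact: le_trans (modulus_coord_le z j) z0.
Qed.

Lemma sqnormN z : sqnorm (- z) = sqnorm z.
Proof.
by rewrite !sqnorm_normc; apply: eq_bigr => j _; rewrite mxE modulusN.
Qed.

Lemma Re_innerC z w : complex.Re (inner_prod z w) = complex.Re (inner_prod w z).
Proof. by rewrite !Re_inner; apply: eq_bigr => j _; rewrite ![complex.Re (z 0 j) * _]mulrC ![complex.Im (z 0 j) * _]mulrC. Qed.

Lemma Re_innerZl (t : R) z w :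
  complex.Re (inner_prod (((t%:C)%C : C) *: z) w) = t * complex.Re (inner_prod z w).
Proof.
rewrite !Re_inner mulr_sumr; apply: eq_bigr => j _; rewrite !mxE.
by case: (z 0 j) => a b; simpc => /=; rewrite mulrDr !mulrA.
Qed.

Lemma sqnormD z w : sqnorm (z + w) = sqnorm z + sqnorm w + 2 * complex.Re (inner_prod z w).
Proof. by rewrite -{1}[w]opprK sqnormB sqnormN Re_innerNr mulrN opprK. Qed.

Lemma sqnormD_le z w : sqnorm (z + w) <= 2 * sqnorm z + 2 * sqnorm w.
Proof. have := sqnorm_ge0 (z - w); rewrite sqnormB sqnormD; lra. Qed.

Lemma modulus_real_sqr (t : R) : normc ((t%:C)%C : C) ^+ 2 = t ^+ 2.
Proof. by rewrite modulus_sqr /= expr0n addr0. Qed.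

(** Add the inequalities at [t] and [- t], for [t] large. *)
Lemma quadratic_bound_lead (a b c : R) :
  (forall t, a * t ^+ 2 + b * t + c <= 0) -> a <= 0.
Proof.
move=> H; rewrite leNgt; apply/negP => a0.
(* then [a * t] exceeds [`|c| + 1], and [t ^+ 2 >= t] *)
pose t := (`|c| + 1) / a + 1.
have at1 : a * t = `|c| + 1 + a by rewrite /t mulrDr mulrC divfK ?gt_eqF// mulr1.
have t1 : 1 <= t by rewrite /t lerDr divr_ge0 ?ltW// ltr_wpDl.
have : a * t <= a * t ^+ 2 by rewrite ler_pM2l// expr2 ler_peMr// (le_trans ler01).
have := H t; have := H (- t); rewrite sqrrN at1.
have := ler_norm (- c); rewrite normrN; lra.
Qed.

Lemma affine_bound_zero (b c : R) : (forall t, b * t + c <= 0) -> b = 0.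
Proof.
move=> H; apply/eqP/negPn/negP => b0.
have := H ((1 - c) / b); rewrite mulrC divfK// subrK.
by rewrite ler10.
Qed.
End sqnorm_theory.

Section growth.
Variables (R : realType) (n : nat).
Local Notation C := (C R).
Local Notation normc := (@Normc.normc R).
Local Notation V := 'rV[C]_n.
Variable phi : V -> V.
Hypothesis phi_hol : holomorphic phi.
Hypothesis bounded : bounded_operator (@fock_space R n) (@fock_norm R n)
                      (composition_operator phi).

(** At [u = phi w], the kernel at [u] takes the value [exp (|u|^2 / 2)]; bounding
    it as the value of [T (kern u)] at [w] leaves
    [exp (|u|^2 / 2) <= B exp (|w|^2 / 2)]. *)
Lemma bounded_growth : exists c0 : R, forall w, sqnorm (phi w) <= sqnorm w + c0.
Proof.
case: bounded => stab _ [M HM].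
pose B := eval_const R n * (`|M| + 1) ^+ 2.
have B0 : 0 < B by rewrite mulr_gt0 ?eval_const_gt0// exprn_gt0// ltr_wpDl.
exists (2 * ln B) => w; set u := phi w.
have [Fu Nu] := fock_kern u.
have H : normc (kern u u) ^+ 2 <=
    eval_const R n * expR (sqnorm w / 2) * fock_norm (kern u \o phi) ^+ 2.
  exact: (fock_eval w (stab _ Fu)).
move: H; rewrite normc_kern Re_inner_self => H.
have NT : fock_norm (kern u \o phi) ^+ 2 <= (`|M| + 1) ^+ 2 * expR (sqnorm u / 2).
  have M1 : 0 <= `|M| + 1 by rewrite addr_ge0.
  have le1 : fock_norm (kern u \o phi) <= (`|M| + 1) * fock_norm (kern u).
    apply: le_trans (HM _ Fu) _; rewrite ler_wpM2r ?fock_norm_ge0//.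
    by apply: le_trans (ler_norm _) _; rewrite lerDl.
  rewrite -Nu -exprMn.
  apply: lerXn2r; rewrite // nnegrE; first exact: fock_norm_ge0.
  by apply: mulr_ge0 => //; exact: fock_norm_ge0.
have : expR (sqnorm u / 2) * expR (sqnorm u / 2) <= B * expR (sqnorm w / 2) * expR (sqnorm u / 2).
  rewrite -expr2; apply: le_trans H _.
  have -> : B * expR (sqnorm w / 2) * expR (sqnorm u / 2) =
      eval_const R n * expR (sqnorm w / 2) * ((`|M| + 1) ^+ 2 * expR (sqnorm u / 2)).
    by rewrite /B; ring.
  by rewrite ler_wpM2l// mulr_ge0 ?expR_ge0// ltW// eval_const_gt0.
by rewrite ler_pM2r ?expR_gt0// -{1}(lnK B0) -expRD ler_expR; lra.
Qed.

Lemma sqrt_affine_bound (x p q t : R) : 0 <= p -> 0 <= q -> 0 <= t -> 0 <= x ->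
  x ^+ 2 <= p + q * t ^+ 2 -> x <= Num.sqrt p + Num.sqrt q * t.
Proof.
move=> p0 q0 t0 x0 H.
have b0 : 0 <= Num.sqrt p + Num.sqrt q * t by rewrite addr_ge0 ?mulr_ge0 ?sqrtr_ge0.
rewrite -(@ler_pXn2r _ 2)// ?nnegrE//; apply: le_trans H _.
rewrite sqrrD exprMn !sqr_sqrtr// addrAC lerDl mulrn_wge0// !mulr_ge0 ?sqrtr_ge0//.
Qed.

(** Liouville's theorem on a complex line, coordinate by coordinate. *)
Lemma phi_line a v : forall t : C, phi (a + t *: v) = phi a + t *: (phi (a + v) - phi a).
Proof.
have [c0 Hc] := bounded_growth.
suff H j : forall t : C, phi (a + t *: v) 0 j = phi a 0 j + t * (phi (a + v) 0 j - phi a 0 j).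
  by move=> t; apply/rowP => j; rewrite H !mxE.
pose h (t : C) : C := phi (a + t *: v) 0 j.
have dh z : derivable h z 1 by exact: (@derivable_line C n n phi a v j z phi_hol).
have hb (t : C) : normc (h t) <= Num.sqrt (2 * sqnorm a + `|c0|) + Num.sqrt (2 * sqnorm v) * normc t.
  have n0 w : 0 <= 2 * sqnorm w by rewrite mulr_ge0// sqnorm_ge0.
  apply: sqrt_affine_bound; [|exact: n0|exact: modulus_ge0|exact: modulus_ge0|].
    by apply: addr_ge0 => //; exact: n0.
  apply: le_trans (modulus_coord_le _ _) _; apply: le_trans (Hc _) _.
  have := sqnormD_le a (t *: v); rewrite sqnormZ; have := ler_norm c0; lra.
have [l Hl] := entire_linear_growth (sqrtr_ge0 _) dh hb.
have h0 : h 0 = phi a 0 j by rewrite /h scale0r addr0.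
have h1 : h 1 = phi (a + v) 0 j by rewrite /h scale1r.
move=> t; rewrite -/(h t) Hl h0; congr (_ + _).
by rewrite -h1 (Hl 1) h0 mulr1 addrAC subrr add0r mulrC.
Qed.

Lemma phi_affine : exists (A : 'M[C]_n) (b : V), forall z, phi z = z *m A + b.
Proof.
pose L z := phi z - phi 0.
have linL : linear L by exact: affine_on_lines_linear phi_line.
pose Ll : {linear V -> V} := HB.pack L (GRing.isLinear.Build _ _ _ _ L linL).
exists (lin1_mx Ll), (phi 0) => z.
by rewrite mul_rV_lin1 /= /L subrK.
Qed.
End growth.

Section affine_growth.
Variables (R : realType) (n : nat).
Local Notation C := (C R).
Local Notation normc := (@Normc.normc R).
Local Notation V := 'rV[C]_n.
Variables (A : 'M[C]_n) (b : V) (c0 : R).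
Hypothesis H : forall w : V, sqnorm (w *m A + b) <= sqnorm w + c0.

Lemma growth_line (w : V) (t : R) : t ^+ 2 * sqnorm (w *m A) +
  2 * t * complex.Re (inner_prod (w *m A) b) + sqnorm b <= t ^+ 2 * sqnorm w + c0.
Proof.
have := H (((t%:C)%C : C) *: w).
rewrite -scalemxAl sqnormD !sqnormZ modulus_real_sqr Re_innerZl mulrA.
by rewrite addrAC.
Qed.

Lemma growth_contraction (w : V) : sqnorm (w *m A) <= sqnorm w.
Proof.
rewrite -subr_le0.
apply: (@quadratic_bound_lead R _ (2 * complex.Re (inner_prod (w *m A) b)) (sqnorm b - c0)) => t.
have := growth_line w t; rewrite -subr_le0; congr (_ <= 0); ring.
Qed.

(** The quadratic terms cancel, and the linear term in [t] must stay bounded. *)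
Lemma growth_orthogonal (w : V) : sqnorm (w *m A) = sqnorm w ->
  complex.Re (inner_prod (w *m A) b) = 0.
Proof.
move=> E; have : 2 * complex.Re (inner_prod (w *m A) b) = 0.
  apply: (@affine_bound_zero R _ (sqnorm b - c0)) => t.
  have := growth_line w t; rewrite E -subr_le0; congr (_ <= 0); ring.
by move=> /eqP; rewrite mulf_eq0 pnatr_eq0/= => /eqP.
Qed.

(** The vector that represents [z |-> z v] through the inner product. *)
Definition conj_row (v : 'cV[C]_n) : V := \row_j ((v j 0)^*)%C.

Lemma inner_conj_row (z : V) (v : 'cV[C]_n) : inner_prod z (conj_row v) = (z *m v) 0 0.
Proof.
by rewrite /inner_prod mxE; apply: eq_bigr => j _; rewrite mxE conjcK.
Qed.

(** If [A v = v] then the conjugate row [u] of [v] satisfies [<u A, u> = |u|^2];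
    as [A] is a contraction, [u A = u], and the boundary case of the growth
    inequality makes [b] orthogonal to [u]. *)
Lemma kernel_orthogonal (v : 'cV[C]_n) : A *m v = v -> complex.Re ((b *m v) 0 0) = 0.
Proof.
move=> Av; pose u := conj_row v.
have inner_A z : inner_prod (z *m A) u = inner_prod z u.
  by rewrite !inner_conj_row -mulmxA Av.
have uA : u *m A = u.
  apply/eqP; rewrite -subr_eq0; apply/eqP/sqnorm_eq0.
  rewrite sqnormB inner_A Re_inner_self; have := growth_contraction u; lra.
rewrite -inner_conj_row -/u Re_innerC -{1}uA; apply: growth_orthogonal.
by rewrite uA.
Qed.

(** A fixed point solves [p (1 - A) = b], which is possible because [b] annihilates
    the columns [v] of the cokernel of [1 - A].  Applying the orthogonality to [v]
    and to [i v] gives the real and the imaginary part. *)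
Lemma growth_fixed_point : exists p : V, p *m A + b = p.
Proof.
have bM : (b <= 1%:M - A)%MS.
  rewrite submxE; apply/eqP/rowP => k; rewrite [RHS]mxE.
  pose v : 'cV[C]_n := cokermx (1%:M - A) *m delta_mx k 0.
  (* the columns of the cokernel matrix span the kernel of [1 - A] *)
  have Mv : (1%:M - A) *m v = 0.
    by rewrite /v mulmxA mulmx_coker mul0mx.
  have Av : A *m v = v.
    by move/eqP: Mv; rewrite mulmxBl mul1mx subr_eq0 => /eqP <-.
  have E (D : 'M[C]_n) : (b *m D) 0 k = (b *m (D *m (delta_mx k 0 : 'cV[C]_n))) 0 0.
    by rewrite mulmxA -colE [RHS]mxE.
  rewrite E -/v.
  have R0 := kernel_orthogonal Av.
  have I0 : complex.Re (('i%C : C) * (b *m v) 0 0) = 0.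
    have := @kernel_orthogonal (('i%C : C) *: v).
    by rewrite -!scalemxAr Av => /(_ erefl); rewrite mxE.
  move: R0 I0; case: ((b *m v) 0 0) => x y; simpc => /= -> /eqP.
  by rewrite oppr_eq0 => /eqP ->.
have [p Hp] := submxP bM.
by exists p; rewrite Hp mulmxBr mulmx1 addrC subrK.
Qed.
End affine_growth.

(** * Composition operators are not supercyclic *)

Section supercyclic.
Variables (R : realType) (n : nat).
Local Notation C := (C R).
Local Notation normc := (@Normc.normc R).
Local Notation V := 'rV[C]_n.
Variable phi : V -> V.
Hypothesis phi_hol : holomorphic phi.
Hypothesis bounded : bounded_operator (@fock_space R n) (@fock_norm R n)
                      (composition_operator phi).

Lemma fixed_point_bounded_orbits : exists2 p : V, phi p = p &
  forall m z, sqnorm (iter m phi z) <= 2 * sqnorm (z - p) + 2 * sqnorm p.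
Proof.
have [c0 Hc] := bounded_growth bounded.
have [A [b phiE]] := phi_affine phi_hol bounded.
have HA w : sqnorm (w *m A + b) <= sqnorm w + c0 by rewrite -phiE.
have [p pE] := growth_fixed_point HA.
exists p; first by rewrite phiE.
move=> m z; have : sqnorm (iter m phi z - p) <= sqnorm (z - p).
  elim: m => [|m IH] //=; rewrite phiE -{1}pE opprD addrACA subrr addr0 -mulmxBl.
  exact: le_trans (growth_contraction HA _) IH.
have := sqnormD_le (iter m phi z - p) p; rewrite subrK; lra.
Qed.

Lemma iter_composition_operator m (f : V -> C) :
  iter m (composition_operator phi) f = f \o iter m phi.
Proof.
elim: m => [|m IH] //=; rewrite IH; apply/funext => z /=.
by rewrite -iterS iterSr.
Qed.

Lemma iter_fock_space m (f : V -> C) : fock_space f -> fock_space (iter m (composition_operator phi) f).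
Proof. by case: bounded => stab _ _ ff; elim: m => //= m; exact: stab. Qed.

Lemma fock_eval_le (f : V -> C) (c : V) (e : R) : fock_space f -> fock_norm f <= e ->
  normc (f c) <= Num.sqrt (eval_const R n * expR (sqnorm c / 2)) * e.
Proof.
move=> ff fe; have e0 : 0 <= e by exact: le_trans (fock_norm_ge0 f) fe.
have k0 : 0 <= eval_const R n * expR (sqnorm c / 2).
  by rewrite mulr_ge0 ?expR_ge0// ltW// eval_const_gt0.
have : normc (f c) ^+ 2 <= (Num.sqrt (eval_const R n * expR (sqnorm c / 2)) * e) ^+ 2.
  rewrite exprMn sqr_sqrtr//; apply: le_trans (fock_eval c ff) _.
  rewrite ler_wpM2l// lerXn2r// nnegrE//; exact: fock_norm_ge0.
rewrite ler_pXn2r// nnegrE; first exact: modulus_ge0.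
by rewrite mulr_ge0// sqrtr_ge0.
Qed.

(** Compare [g] with nearby vectors [a T^m f] of the projective orbit: the value at
    the fixed point controls [a], and then the value at [z] is controlled by the bound
    of [f] along the orbit of [z]. *)
Lemma supercyclic_ratio (f : V -> C) (p z : V) (B : R) :
  norm_dense (@fock_space R n) (@fock_norm R n)
    (projective_orbit (composition_operator phi) f) ->
  fock_space f -> phi p = p -> (forall m, normc (f (iter m phi z)) <= B) ->
  exists K : R, forall g : V -> C, fock_space g -> normc (g z) <= K * normc (g p).
Proof.
move=> dense ff pp HB.
have iterp m : iter m phi p = p by elim: m => //= m ->.
pose Kp := Num.sqrt (eval_const R n * expR (sqnorm p / 2)).
pose Kz := Num.sqrt (eval_const R n * expR (sqnorm z / 2)).
have [Kp0 Kz0] : 0 <= Kp /\ 0 <= Kz by split; exact: sqrtr_ge0.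
have B0 : 0 <= B by apply: le_trans (HB 0%N); exact: modulus_ge0.
have tri (x y : C) : normc x <= normc (x - y) + normc y.
  by rewrite -{1}(subrK y x); exact: le_normcD.
have approx (g : V -> C) (e : R) : fock_space g -> 0 < e -> exists a m,
    normc (g p - a * f p) <= Kp * e /\ normc (g z - a * f (iter m phi z)) <= Kz * e.
  move=> fg e0; have [h [m [a ->]] he] := dense g fg e e0.
  have fh := fock_space_subZ a fg (iter_fock_space m ff).
  exists a, m; split.
  - have := fock_eval_le p fh (ltW he).
    by rewrite iter_composition_operator /= -[in f _](iterp m).
  - have := fock_eval_le z fh (ltW he).
    by rewrite iter_composition_operator.
(* otherwise all limits would vanish at [p], among them [kern 0], which is [1] *)
have fp0 : 0 < normc (f p).
  rewrite lt_neqAle modulus_ge0 andbT eq_sym; apply/negP => /eqP /Normc.eq0_normc f0.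
  have [k0 _] := fock_kern (0 : V).
  have e0 : 0 < (2 * (Kp + 1))^-1 by rewrite invr_gt0 mulr_gt0// ltr_wpDl.
  have [a [m [h _]]] := approx _ _ k0 e0.
  move: h; rewrite f0 mulr0 subr0 normc_kern Re_innerC Re_inner big1; last first.
    by move=> i _; rewrite !mxE /= !mul0r addr0.
  rewrite mul0r expR0 leNgt => /negP; apply.
  by rewrite ltr_pdivrMr ?mulr_gt0 ?ltr_wpDl//; lra.
exists (B / normc (f p)) => g fg.
have L0 : 0 <= Kz + B / normc (f p) * Kp.
  by rewrite addr_ge0// mulr_ge0// divr_ge0// modulus_ge0.
apply: (le_of_inv_bound L0) => r r0.
have ri : 0 < r^-1 by rewrite invr_gt0.
have [a [m [h1 h2]]] := approx g _ fg ri.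
have na : normc a * normc (f p) <= normc (g p) + Kp * r^-1.
  rewrite -Normc.normcM; apply: le_trans (tri _ (g p)) _; rewrite addrC lerD2l.
  by rewrite -modulusN opprB.
apply: le_trans (tri _ (a * f (iter m phi z))) _.
rewrite mulrDl addrCA lerD// Normc.normcM.
apply: le_trans (ler_wpM2l (modulus_ge0 a) (HB m)) _.
have -> : normc a * B = B / normc (f p) * (normc a * normc (f p)).
  by rewrite mulrCA mulrAC -mulrA divff ?gt_eqF// mulr1 mulrC.
rewrite -[X in _ <= _ + X]mulrA -mulrDr ler_wpM2l//.
by rewrite divr_ge0// modulus_ge0.
Qed.
End supercyclic.

Theorem theorem5p4 (R : realType) (n : nat) (n_ge1 : (1 <= n)%N)
    (phi : 'rV[C R]_n -> 'rV[C R]_n) (phi_hol : holomorphic phi)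
    (Cphi_bounded : bounded_operator (@fock_space R n) (@fock_norm R n)
                      (composition_operator phi)) :
  ~ supercyclic (@fock_space R n) (@fock_norm R n) (composition_operator phi).
Proof.
move=> [f ff dense].
have [p pp orb] := fixed_point_bounded_orbits phi_hol Cphi_bounded.
pose w : 'rV[C R]_n := const_mx 1; pose z := p + w.
have w0 : 0 < sqnorm w.
  rewrite lt_neqAle sqnorm_ge0 andbT; apply/eqP => w0.
  have /rowP/(_ (Ordinal n_ge1)) : w = 0 by apply: sqnorm_eq0; rewrite -w0.
  by rewrite !mxE => /eqP; rewrite oner_eq0.
pose M := 2 * sqnorm (z - p) + 2 * sqnorm p.
pose B := Num.sqrt (eval_const R n * expR (M / 2)) * fock_norm f.
have HB m : Normc.normc (f (iter m phi z)) <= B.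
  apply: le_trans (fock_eval_le _ ff (lexx _)) _.
  apply: ler_wpM2r; first exact: fock_norm_ge0.
  apply: ler_wsqrtr; rewrite ler_pM2l ?eval_const_gt0// ler_expR ler_pM2r ?invr_gt0//.
have [K HK] := supercyclic_ratio Cphi_bounded dense ff pp HB.
(* the values of the kernel at [z] and [p] then have ratio [expR (`|K| + 1)] *)
pose t : R := 2 * (`|K| + 1) / sqnorm w.
have t0 : 0 <= t.
  by rewrite divr_ge0 ?sqnorm_ge0// mulr_ge0// addr_ge0.
have [fk _] := fock_kern (((t%:C)%C : C R) *: w).
have := HK _ fk; rewrite !normc_kern !(Re_innerC _ (_ *: w)) !Re_innerZl.
rewrite Re_innerDr Re_inner_self mulrDr mulrDl expRD mulrC.
rewrite ler_pM2r ?expR_gt0//.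
have -> : t * sqnorm w / 2 = `|K| + 1.
  by rewrite /t divfK ?gt_eqF// mulrAC divff ?pnatr_eq0// mul1r.
have := expR_ge1Dx (`|K| + 1); have := ler_norm K; lra.
Qed.
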